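(* Let $r\ge1$ be an integer, let $\Omega\subseteq\mathbb R^{n+m}$ be open, and let $F:\Omega\to\mathbb R^n$ be of class $C^r$. Let $\Delta>0$, let $N$ be a positive integer, and let $S_\Delta$ be the zero-order-hold sampled transition map of $\dot x(t)=F(x(t),u(t))$, with domain $\mathcal O_\Delta$. Then the finite-horizon behavior of the zero-order-hold sampled system $x_{k+1}=S_\Delta(x_k,u_k)$, namely $$\{\operatorname{col}(u_0,\ldots,u_{N-1},x_0,\ldots,x_N)\in\mathbb R^{Nm+(N+1)n} : (x_k,u_k)\in\mathcal O_\Delta,\ x_{k+1}=S_\Delta(x_k,u_k),\ k=0,\ldots,N-1\},$$ is a $C^r$ embedded submanifold of $\mathbb R^{Nm+(N+1)n}$ of dimension $n+Nm$.
   Context: Here $n,m,N$ are positive integers, $x_k\in\mathbb R^n$, $u_k\in\mathbb R^m$, and $\operatorname{col}(\cdot)$ denotes vertical stacking of vectors. A pair $(x,u)\in\mathbb R^n\times\mathbb R^m$ is identified with a point of $\mathbb R^{n+m}$. The domain $\mathcal O_\Delta\subseteq\mathbb R^{n+m}$ is the set of all $(\bar x,u)\in\Omega$ such that, with the input held constant at $u$, the initial value problem $\dot x(t)=F(x(t),u)$, $x(0)=\bar x$, has a (necessarily unique) solution on the whole interval $[0,\Delta]$ with $(x(t),u)\in\Omega$ for all $t\in[0,\Delta]$. For $(\bar x,u)\in\mathcal O_\Delta$, $S_\Delta(\bar x,u):=x(\Delta)$ is the value at time $\Delta$ of this solution. Convention: the empty set is regarded as an embedded submanifold of any dimension. *)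

(* Defs.v *)
From HB Require Import structures.
From mathcomp Require Import all_boot all_order all_algebra.
From mathcomp Require Import all_classical all_reals all_analysis.

Set Implicit Arguments.
Unset Strict Implicit.
Unset Printing Implicit Defensive.

Import Order.TTheory GRing.Theory Num.Theory.
Import numFieldNormedType.Exports.

Local Open Scope classical_set_scope.
Local Open Scope ring_scope.

(* Points of R^p are row vectors ['rV[R]_p], so col(a, b) is [row_mx a b] and
   the pair (x, u) is [row_mx x u]. *)

(* [f] is of class C^k on [U], for [U] open.  In finite dimension, x |-> 'd f x
   is of class C^(k-1) iff x |-> 'd f x v = 'D_v f x is so for each fixed [v].
   As [U] is open, only the values of [f] on [U] matter. *)
Fixpoint class_C (R : realType) (p q k : nat) (U : set 'rV[R]_p)
    (f : 'rV[R]_p -> 'rV[R]_q) : Prop :=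
  if k is k'.+1 then
    (forall x, U x -> differentiable f x) /\
    (forall v, class_C k' U ('D_v f))
  else forall x, U x -> {for x, continuous f}.

Definition C_diffeomorphism (R : realType) (d r : nat) (U V : set 'rV[R]_d)
    (phi psi : 'rV[R]_d -> 'rV[R]_d) : Prop :=
  [/\ class_C r U phi, class_C r V psi,
      phi @` U `<=` V, psi @` V `<=` U &
      (forall y, U y -> psi (phi y) = y) /\
      (forall z, V z -> phi (psi z) = z)].

(* The subspace R^k x {0} of R^d (meaningful for k <= d). *)
Definition coordinate_slice (R : realType) (d k : nat) : set 'rV[R]_d :=
  [set y | forall i : 'I_d, (k <= i)%N -> y ord0 i = 0].
Arguments coordinate_slice : clear implicits.

(* [M] is a C^r embedded submanifold of R^d of dimension [k]: around each of
   its points there is a C^r chart of R^d flattening [M] to R^k x {0}.  The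
   empty set qualifies for every [k]. *)
Definition embedded_submanifold (R : realType) (d r k : nat)
    (M : set 'rV[R]_d) : Prop :=
  forall p, M p ->
    (k <= d)%N /\
    exists (U V : set 'rV[R]_d) (phi psi : 'rV[R]_d -> 'rV[R]_d),
      [/\ open U, U p, open V, C_diffeomorphism r U V phi psi &
          phi @` (M `&` U) = V `&` coordinate_slice R d k].

Section ZeroOrderHold.
Variables (R : realType) (n m : nat).
(* [F] is only ever evaluated on [Omega]. *)
Variables (Omega : set 'rV[R]_(n + m)) (F : 'rV[R]_(n + m) -> 'rV[R]_n).
Variable Delta : R.

(* [x] solves x' = F(x, u), x(0) = xbar on [0, Delta] and stays in [Omega].
   The derivative is that of [x] restricted to [0, Delta], hence one-sided at
   0 and at Delta; the values of [x] outside [0, Delta] are irrelevant. *)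
Definition zoh_solution (xbar : 'rV[R]_n) (u : 'rV[R]_m) (x : R -> 'rV[R]_n) :
    Prop :=
  x 0 = xbar /\
  forall t, 0 <= t <= Delta ->
    Omega (row_mx (x t) u) /\
    (fun s => (s - t)^-1 *: (x s - x t)) @ within `[0, Delta] (t^')
      --> F (row_mx (x t) u).

Definition zoh_domain : set 'rV[R]_(n + m) :=
  [set z | Omega z /\ exists x, zoh_solution (lsubmx z) (rsubmx z) x].

(* The junk value 0 is taken outside [zoh_domain]. *)
Definition zoh_map (z : 'rV[R]_(n + m)) : 'rV[R]_n :=
  xget 0 [set y | exists2 x, zoh_solution (lsubmx z) (rsubmx z) x &
                             x Delta = y].

Definition stack (p N : nat) (v : nat -> 'rV[R]_p) : 'rV[R]_(N * p) :=
  mxvec (\matrix_(k < N) v k).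

Definition zoh_behavior (N : nat) : set 'rV[R]_(N * m + N.+1 * n) :=
  [set w | exists (u : nat -> 'rV[R]_m) (x : nat -> 'rV[R]_n),
     w = row_mx (stack N u) (stack N.+1 x) /\
     forall k, (k < N)%N ->
       zoh_domain (row_mx (x k) (u k)) /\
       x k.+1 = zoh_map (row_mx (x k) (u k))].

End ZeroOrderHold.

Arguments zoh_behavior {R n m} Omega F Delta N.

(* Main.v *)
From HB Require Import structures.
Require Import Defs.
From mathcomp Require Import all_boot all_order all_algebra.
From mathcomp Require Import all_classical all_reals all_analysis.
From mathcomp Require Import ring lra.
Import Order.TTheory GRing.Theory Num.Theory.
Import numFieldNormedType.Exports.

Set Implicit Arguments.
Unset Strict Implicit.
Unset Printing Implicit Defensive.

Local Open Scope classical_set_scope.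
Local Open Scope ring_scope.

(** The behavior is a graph: it is determined by the inputs and the initial state,
    the later states being given by the sampled map. Replacing each state [x_(k+1)]
    by its defect [x_(k+1) - S (x_k, u_k)] is a triangular change of coordinates,
    inverted by running the recursion, which carries the behavior to the subspace
    where all defects vanish ([behavior_submanifold]). This change of coordinates and its
    inverse are of class C^r as soon as the sampled map is of class C^r on an open domain.

    With the input adjoined to the state as a constant of the motion, the sampled map
    is a component of the time-[Delta] map of an autonomous equation [z' = G z] with
    [G] of class C^r ([zoh_map_class_C]), and the point is the classical smooth
    dependence of solutions on initial values. Let [x] be a solution on [0, T]. By
    compactness, [G] is close to its linearization along [x] on a tube around [x]
    ([tube]). Composing [G] with a retraction onto the tube gives a globally
    Lipschitz field, whose solutions exist by Picard iteration ([picard]) and, by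
    Gronwall's inequality ([gronwall]), remain in the tube when they start near
    [x 0]; hence the domain of the flow is open and the flow is Lipschitz
    ([flow_nearby]). Linearizing along [x] shows that the flow is differentiable,
    its derivative being the solution of the variational equation
    ([flow_differentiable]), and the same estimates make this derivative continuous
    ([flow_class_C1]). For larger r, the derivative is itself a component of the
    flow of the equation coupled with its variational equation, a system of class
    C^(r-1), and induction on r concludes ([flow_class_C]). *)

(** * Maps of class C^k between spaces of row vectors *)

Section MatrixNorm.
Context {R : realType}.

Lemma le_norm_coord m n (A : 'M[R]_(m, n)) i j : `|A i j| <= `|A|.
Proof.
rewrite [leRHS]/Num.Def.normr/= mx_normrE.
exact: (le_bigmax _ _ (i, j)).
Qed.

Lemma norm_le_coord m n (A : 'M[R]_(m, n)) c :
  0 <= c -> (forall i j, `|A i j| <= c) -> `|A| <= c.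
Proof.
move=> c0 Ac; rewrite [leLHS]/Num.Def.normr/= mx_normrE.
by apply/bigmax_le => // -[i j] _; exact: Ac.
Qed.

Lemma le_norm_subr_coord m n (A B : 'M[R]_(m, n)) i j :
  `|A i j - B i j| <= `|A - B|.
Proof. by have := le_norm_coord (A - B) i j; rewrite !mxE. Qed.

Lemma norm_subr_le_coord m n (A B : 'M[R]_(m, n)) c :
  0 <= c -> (forall i j, `|A i j - B i j| <= c) -> `|A - B| <= c.
Proof. by move=> c0 ABc; apply: norm_le_coord => // i j; rewrite !mxE. Qed.

Lemma norm_mulmx_le p q (u : 'rV[R]_p) (A : 'M[R]_(p, q)) :
  `|u *m A| <= p%:R * `|A| * `|u|.
Proof.
apply: norm_le_coord => [|i j]; first by rewrite !mulr_ge0.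
rewrite mxE (le_trans (ler_norm_sum _ _ _))//.
apply: (@le_trans _ _ (\sum_(k < p) `|A| * `|u|)).
  apply: ler_sum => k _; rewrite normrM mulrC.
  by apply: ler_pM => //; exact: le_norm_coord.
by rewrite sumr_const card_ord -mulrA mulr_natl.
Qed.

Lemma linear_rV_continuous p q (f : {linear 'rV[R]_p -> 'rV[R]_q}) :
  continuous f.
Proof.
apply: bounded_linear_continuous; apply/linear_boundedP.
near=> c => x; rewrite -(mul_rV_lin1 f).
apply: (le_trans (norm_mulmx_le _ _)); apply: ler_wpM2r; first by [].
by near: c; apply: nbhs_pinfty_ge; rewrite num_real.
Unshelve. all: by end_near. Qed.

Lemma linear_rV_differentiable p q (f : {linear 'rV[R]_p -> 'rV[R]_q}) x :
  differentiable f x.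
Proof. by apply: linear_differentiable; exact: linear_rV_continuous. Qed.

Lemma derive_linear p q (f : {linear 'rV[R]_p -> 'rV[R]_q}) v x :
  'D_v f x = f v.
Proof.
rewrite deriveE; last exact: linear_rV_differentiable.
by rewrite diff_lin//; exact: linear_rV_continuous.
Qed.

Lemma differentiable_epsP (V W : normedModType R) (f : V -> W) (x : V)
    (A : {linear V -> W}) :
  continuous A ->
  (forall e, 0 < e ->
     \forall h \near (0 : V), `|f (h + x) - f x - A h| <= e * `|h|) <->
  differentiable f x /\ 'd f x = A :> (_ -> _).
Proof.
move=> Ac; split=> [fA|[df <- e e0]]; last first.
  have /diff_locally/eqaddoP/(_ e e0) := df.
  by apply: filterS => h; rewrite !fctE/= opprD addrA.
have dE : f \o shift x = cst (f x) + A +o_ 0 id.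
  apply/eqaddoP => e /fA; apply: filterS => h.
  by rewrite !fctE/= opprD addrA.
have dfE := diff_unique Ac dE.
by split => //; apply/diff_locallyP; rewrite dfE.
Qed.

Lemma near_eq_differentiable (V W : normedModType R) (f g : V -> W) (x : V) :
  (\forall y \near x, f y = g y) -> differentiable f x -> differentiable g x.
Proof.
move=> fg df; have dfc := diff_continuous df.
apply: (proj1 ((differentiable_epsP g x dfc).1 _)) => e e0.
have fgx : f x = g x by exact: nbhs_singleton fg.
have fg0 : \forall h \near (0 : V), f (h + x) = g (h + x).
  by move: fg; rewrite (near_shift 0) subr0.
have := (differentiable_epsP f x dfc).2 (conj df erefl) e e0.
by apply: filterS2 fg0 => h ->; rewrite fgx.
Qed.

Lemma derive_coord p q (f : 'rV[R]_p -> 'rV[R]_q) v x i :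
  differentiable f x -> 'D_v f x 0 i = 'D_v (fun y => f y 0 i) x.
Proof. by move=> df; rewrite derive_mx ?mxE//; exact: diff_derivable. Qed.

(** [class_C] differentiates along fixed directions; this reduces to them a
    direction that varies with the point, as in the chain rule. *)
Lemma derive_coord_sum p q (f : 'rV[R]_p -> 'rV[R]_q) v x :
  differentiable f x ->
  'D_v f x = \sum_(j < p) v 0 j *: 'D_(delta_mx 0 j) f x.
Proof.
move=> df; rewrite deriveE// {1}(row_sum_delta v) linear_sum.
by apply: eq_bigr => j _; rewrite linearZ deriveE.
Qed.

End MatrixNorm.

Section ClassC.
Context {R : realType}.

Lemma class_C_sub p q k (U V : set 'rV[R]_p) (f : 'rV[R]_p -> 'rV[R]_q) :
  V `<=` U -> class_C k U f -> class_C k V f.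
Proof.
move=> VU; elim: k f => [|k IH] f /=; first by move=> fU x /VU/fU.
by move=> [fU dU]; split=> [x /VU/fU//|v]; exact: IH.
Qed.

Lemma class_C_eq p q k (U : set 'rV[R]_p) (f g : 'rV[R]_p -> 'rV[R]_q) :
  open U -> (forall x, U x -> f x = g x) -> class_C k U f -> class_C k U g.
Proof.
move=> oU; have nU x : U x -> nbhs x U by move=> Ux; exact: open_nbhs_nbhs.
elim: k f g => [|k IH] f g fg /=.
  move=> fU x Ux; rewrite /prop_for /continuous_at -(fg x Ux).
  have fgx : {near x, f =1 g} by apply: filterS (nU _ Ux) => y; exact: fg.
  exact: cvg_trans (near_eq_cvg fgx) (fU x Ux).
move=> [fU dU]; split=> [x Ux|v].
  apply: near_eq_differentiable (fU x Ux).
  by apply: filterS (nU _ Ux) => y Uy; exact: fg.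
apply: IH (dU v) => x Ux; apply: near_eq_derive.
by apply: filterS (nU _ Ux) => y Uy; exact: fg.
Qed.

Lemma class_C_pred p q k (U : set 'rV[R]_p) (f : 'rV[R]_p -> 'rV[R]_q) :
  class_C k.+1 U f -> class_C k U f.
Proof.
elim: k f => [|k IH] f.
  by move=> [fU _] x Ux; apply: differentiable_continuous; exact: fU.
by move=> [fU dU]; split=> // v; exact: IH.
Qed.

Lemma class_C_one p q k (U : set 'rV[R]_p) (f : 'rV[R]_p -> 'rV[R]_q) :
  class_C k.+1 U f -> class_C 1 U f.
Proof. by elim: k => [//|k IH] /class_C_pred. Qed.

Lemma class_C_continuous p q k (U : set 'rV[R]_p) (f : 'rV[R]_p -> 'rV[R]_q) :
  class_C k U f -> forall x, U x -> {for x, continuous f}.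
Proof. by elim: k => [//|k IH] /class_C_pred. Qed.

Lemma class_C_cst p q k (U : set 'rV[R]_p) (a : 'rV[R]_q) :
  class_C k U (cst a).
Proof.
elim: k a => [|k IH] a /=; first by move=> x _; exact: cst_continuous.
split=> [x _|v]; first exact: differentiable_cst.
by rewrite (_ : derive _ ^~ v = cst 0)//; apply/funext => x; exact: derive_cst.
Qed.

Lemma class_C_linear p q k (U : set 'rV[R]_p)
  (f : {linear 'rV[R]_p -> 'rV[R]_q}) : class_C k U f.
Proof.
case: k => [|k] /=; first by move=> x _; exact: linear_rV_continuous.
split=> [x _|v]; first exact: linear_rV_differentiable.
rewrite (_ : derive _ ^~ v = cst (f v)); first exact: class_C_cst.
by apply/funext => x; exact: derive_linear.
Qed.

Lemma class_CD p q k (U : set 'rV[R]_p) (f g : 'rV[R]_p -> 'rV[R]_q) :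
  open U -> class_C k U f -> class_C k U g -> class_C k U (f + g).
Proof.
move=> oU; elim: k f g => [|k IH] f g /=.
  by move=> fU gU x Ux; apply: continuousD; [exact: fU|exact: gU].
move=> [fU dfU] [gU dgU]; split=> [x Ux|v].
  by apply: differentiableD; [exact: fU|exact: gU].
apply: (class_C_eq oU _ (IH _ _ (dfU v) (dgU v))) => x Ux.
by rewrite deriveD//; apply: diff_derivable; [exact: fU|exact: gU].
Qed.

Lemma class_C_sum p q k (U : set 'rV[R]_p) I (s : seq I)
    (f : I -> 'rV[R]_p -> 'rV[R]_q) :
  open U -> (forall i, class_C k U (f i)) ->
  class_C k U (fun x => \sum_(i <- s) f i x).
Proof.
move=> oU fU; elim: s => [|i s IH].
  by apply: (class_C_eq oU _ (class_C_cst k U 0)) => x _; rewrite big_nil.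
by apply: (class_C_eq oU _ (class_CD oU (fU i) IH)) => x _; rewrite big_cons.
Qed.

(** The Leibniz rule. The scalar factor is a coordinate of a vector-valued map,
    which is how scalars occur in the chain rule. *)
Lemma class_C_scale p q s k (U : set 'rV[R]_p) (a : 'rV[R]_p -> 'rV[R]_q)
    (b : 'rV[R]_p -> 'rV[R]_s) (j : 'I_q) :
  open U -> class_C k U a -> class_C k U b ->
  class_C k U (fun x => a x 0 j *: b x).
Proof.
move=> oU; elim: k a b => [|k IH] a b.
  move=> aU bU x Ux.
  have ax : {for x, continuous ((fun N : 'rV_q => N 0 j) \o a)}.
    by apply: continuous_comp; [exact: aU|exact: coord_continuous].
  exact: cvgZ ax (bU x Ux).
move=> aU bU.
have da x : U x -> differentiable (fun y => a y 0 j) x.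
  move=> Ux; apply: (@differentiable_comp _ _ _ _ a (fun N : 'rV_q => N 0 j)).
    exact: aU.1.
  exact: differentiable_coord.
have db x i : U x -> differentiable (fun y => b y 0 i) x.
  move=> Ux; apply: (@differentiable_comp _ _ _ _ b (fun N : 'rV_s => N 0 i)).
    exact: bU.1.
  exact: differentiable_coord.
have dab x : U x -> differentiable (fun y => a y 0 j *: b y) x.
  move=> Ux.
  have -> : (fun y => a y 0 j *: b y) =
      \sum_(i < s) (fun y => (a y 0 j * b y 0 i) *: delta_mx 0 i).
    apply/funext => y; rewrite fct_sumE {1}(row_sum_delta (b y)) scaler_sumr.
    by apply: eq_bigr => i _; rewrite scalerA.
  apply: differentiable_sum => i; apply: differentiableZl.
  by apply: differentiableM; [exact: da|exact: db].
split=> [//|v].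
have aU' := class_C_pred aU; have bU' := class_C_pred bU.
apply: (class_C_eq oU _
  (class_CD oU (IH _ _ (aU.2 v) bU') (IH _ _ aU' (bU.2 v)))) => x Ux.
rewrite fctE; apply/rowP => i.
rewrite !mxE [RHS]derive_coord; last exact: dab.
rewrite (_ : (fun _ => _) = (fun y => a y 0 j) * (fun y => b y 0 i)); last first.
  by apply/funext => y; rewrite mxE.
rewrite deriveM; [|exact/diff_derivable/da|exact/diff_derivable/db].
rewrite (derive_coord _ _ (aU.1 x Ux)) (derive_coord _ _ (bU.1 x Ux)).
by rewrite addrC; congr (_ + _); rewrite mulrC.
Qed.

(** The derivative of [g \o f] along [v] is the sum of the partial derivatives
    of [g] at [f x] weighted by the coordinates of ['D_v f x]; by induction each
    summand is a product of maps of one class less. *)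
Lemma class_C_comp p q s k (U : set 'rV[R]_p) (V : set 'rV[R]_q)
    (f : 'rV[R]_p -> 'rV[R]_q) (g : 'rV[R]_q -> 'rV[R]_s) :
  open U -> (forall x, U x -> V (f x)) ->
  class_C k U f -> class_C k V g -> class_C k U (g \o f).
Proof.
move=> oU fUV; elim: k f g fUV => [|k IH] f g fUV.
  by move=> fU gV x Ux; apply: continuous_comp; [exact: fU|exact/gV/fUV].
move=> fU gV; split=> [x Ux|v].
  by apply: differentiable_comp; [exact: fU.1|exact/gV.1/fUV].
have fU' := class_C_pred fU.
have H j := class_C_scale j oU (fU.2 v) (IH _ _ fUV fU' (gV.2 (delta_mx 0 j))).
apply: (class_C_eq oU _ (class_C_sum (index_enum 'I_q) oU H)) => x Ux.
have dfx := fU.1 _ Ux; have dgx := gV.1 _ (fUV _ Ux).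
rewrite [RHS]deriveE; last exact: differentiable_comp.
by rewrite diff_comp//= -deriveE// -(deriveE _ dfx) (derive_coord_sum _ dgx).
Qed.

End ClassC.

(** * Derivatives of curves on a segment *)

Lemma continuous_near_dist (R : realType) (S : topologicalType)
    (V : normedModType R) (f : S -> V) (z : S) (e : R) :
  {for z, continuous f} -> 0 < e -> \forall y \near z, `|f z - f y| <= e.
Proof. by move=> fz e0; have /cvgrPdist_le := fz; exact. Qed.

Lemma near_dist_lt (R : realType) (V : normedModType R) (z : V) (r : R) :
  0 < r -> \forall y \near z, `|z - y| < r.
Proof. by move=> r0; apply/nbhs_ballP; exists r => //= y; rewrite -ball_normE. Qed.

Lemma near_dist_continuous (R : realType) (S : topologicalType)
    (V : normedModType R) (f : S -> V) (z : S) :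
  (forall e, 0 < e -> \forall y \near z, `|f z - f y| <= e) ->
  {for z, continuous f}.
Proof. by move=> fz; apply/cvgrPdist_le. Qed.

(** [v] is the derivative at [t] of the restriction of [x] to [0, T], one-sided
    at both ends: the notion used by [zoh_solution]. *)
Definition wder (R : realType) (V : normedModType R) (T : R) (x : R -> V)
    (t : R) (v : V) : Prop :=
  (fun s => (s - t)^-1 *: (x s - x t)) @ within `[0, T] (t^') --> v.

Lemma cvg_ext (T : Type) (U : topologicalType) (F : set_system T)
    (f g : T -> U) (l : U) : (forall s, f s = g s) -> f @ F --> l -> g @ F --> l.
Proof. by move/funext => ->. Qed.

Definition clamp (R : realType) (a b t : R) : R := Num.max a (Num.min t b).

Section Clamp.
Context {R : realType}.

Lemma clamp_in (a b t : R) : a <= b -> a <= clamp a b t <= b.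
Proof. by move=> ab; rewrite /clamp le_max lexx/= ge_max ab ge_min lexx orbT. Qed.

Lemma clamp_id (a b t : R) : a <= t <= b -> clamp a b t = t.
Proof. by case/andP=> at_ tb; rewrite /clamp min_l// max_r. Qed.

Lemma clamp_dist (a b s t : R) : `|clamp a b s - clamp a b t| <= `|s - t|.
Proof.
wlog st : s t / s <= t => [H|].
  by have [/H//|/ltW/H] := leP s t; rewrite distrC [leRHS]distrC.
have le1 : clamp a b s <= clamp a b t.
  rewrite /clamp ge_max !le_max lexx/=; apply/orP; right.
  by rewrite le_min !ge_min lexx st/= orbT.
rewrite [leLHS]distrC [leRHS]distrC !ger0_norm ?subr_ge0//.
rewrite lerBlDr /clamp; rewrite ge_max ge_min.
apply/andP; split.
  apply: (@le_trans _ _ (Num.max a (Num.min s b))); first by rewrite le_max lexx.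
  by rewrite lerDr subr_ge0.
have [sb|bs] := leP s b; last first.
  apply/orP; right; rewrite (@le_trans _ _ (Num.max a b))// ?lerDr ?subr_ge0//.
  by rewrite le_max lexx orbT.
by apply/orP; left; rewrite -lerBlDl opprB addrC subrK le_max lexx orbT.
Qed.

End Clamp.

Section TimeDerivative.
Context {R : realType} {V : normedModType R}.
Implicit Types (x y : R -> V) (T t : R) (v w : V).

Lemma wderP T x t v : wder T x t v <->
  forall e, 0 < e -> exists2 d, 0 < d & forall s, 0 <= s <= T -> `|s - t| < d ->
    `|x s - x t - (s - t) *: v| <= e * `|s - t|.
Proof.
have E s : s != t -> `|x s - x t - (s - t) *: v| =
    `|s - t| * `|v - (s - t)^-1 *: (x s - x t)|.
  move=> st; rewrite -normrZ scalerBr scalerA divff ?subr_eq0// scale1r.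
  by rewrite distrC.
split=> [/cvgrPdist_le xv e e0|H].
  have [d /= d0 dP] := xv e e0; exists d => // s sT std.
  have [->|st] := eqVneq s t; first by rewrite !subrr scale0r subrr !normr0 mulr0.
  rewrite E// mulrC ler_wpM2r//; apply: dP => //.
  by rewrite /ball_/= distrC.
apply/cvgrPdist_le => e e0; have [d d0 dP] := H e e0.
exists d => //= s; rewrite /ball_/= distrC => std st; rewrite in_itv/= => sT.
have := dP s sT std; rewrite E// mulrC ler_pM2r// normr_gt0 subr_eq0//.
Qed.

Lemma wder_cst T (a : V) t : wder T (cst a) t 0.
Proof.
apply/wderP => e e0; exists 1 => // s _ _.
by rewrite !fctE subrr scaler0 subrr normr0 mulr_ge0// ltW.
Qed.

Lemma wderD T x y t v w : wder T x t v -> wder T y t w ->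
  wder T (fun s => x s + y s) t (v + w).
Proof.
move=> xv yw; apply: cvg_ext (cvgD xv yw) => s.
by rewrite !fctE -scalerDr opprD addrACA.
Qed.

Lemma wderB T x y t v w : wder T x t v -> wder T y t w ->
  wder T (fun s => x s - y s) t (v - w).
Proof.
move=> xv yw; apply: cvg_ext (cvgB xv yw) => s.
rewrite !fctE -scalerBr; congr (_ *: _).
by rewrite !opprD !opprK addrACA.
Qed.

Lemma wder_sum T I (r : seq I) (x : I -> R -> V) t (v : I -> V) :
  (forall i, wder T (x i) t (v i)) ->
  wder T (fun s => \sum_(i <- r) x i s) t (\sum_(i <- r) v i).
Proof.
move=> xv; elim: r => [|i r IH].
  by rewrite big_nil (_ : (fun _ => _) = cst 0);
    [exact: wder_cst|apply/funext => s; rewrite big_nil].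
rewrite big_cons (_ : (fun _ => _) = (fun s => x i s + \sum_(i <- r) x i s)).
  exact: wderD.
by apply/funext => s; rewrite big_cons.
Qed.

Lemma wder_eq T x y t v : 0 <= t <= T -> (forall s, 0 <= s <= T -> x s = y s) ->
  wder T x t v -> wder T y t v.
Proof.
move=> tT xy /wderP H; apply/wderP => e /H[d d0 dP]; exists d => // s sT.
by rewrite -!xy//; exact: dP.
Qed.

Lemma wder_linear (W : normedModType R) (A : {linear V -> W}) T x t v :
  continuous A -> wder T x t v -> wder T (A \o x) t (A v).
Proof.
move=> Ac xv; apply: cvg_ext (continuous_cvg _ (Ac v) xv) => s /=.
by rewrite linearZ linearB.
Qed.

Lemma is_derive_wder T x t v : is_derive t 1 x v -> wder T x t v.
Proof.
case=> /derivable1_diffP dx <-; apply/wderP => e e0.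
have dxc := diff_continuous dx.
have := (differentiable_epsP x t dxc).2 (conj dx erefl) e e0.
move=> [d /= d0 dP]; exists d => // s _ std.
have := dP (s - t); rewrite /ball_/= sub0r normrN subrK => /(_ std).
have -> // : 'd x t (s - t) = (s - t) *: 'D_1 x t.
by rewrite deriveE// -[X in 'd _ _ X = _]mulr1 [LHS]linearZ.
Qed.

(** At interior times the restriction does not matter, so that the mean value
    theorem becomes available. *)
Lemma wder_is_derive T x t v : 0 < t < T -> wder T x t v -> is_derive t 1 x v.
Proof.
move=> /andP[t0 tT] /wderP xv.
have xt : h^-1 *: (x (h + t) - x t) @[h --> 0^'] --> v.
  apply/cvgrPdist_le => e e0; have [d d0 dP] := xv e e0.
  near=> h.
  have h0 : h != 0 by near: h; exact: nbhs_dnbhs_neq.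
  have hd : `|h| < d by near: h; exact: dnbhs0_lt.
  have ht : 0 <= h + t <= T.
    have h1 : `|h| < t by near: h; exact: dnbhs0_lt.
    have h2 : `|h| < T - t by near: h; apply: dnbhs0_lt; rewrite subr_gt0.
    move/ltr_normlW: h2 => h2; rewrite -lerBrDr (ltW h2) andbT.
    by rewrite -lerBlDr sub0r lerNl; rewrite -normrN in h1; exact/ltW/ltr_normlW.
  have := dP (h + t) ht; rewrite addrK => /(_ hd) H.
  rewrite -(ler_pM2l (x := `|h|)) ?normr_gt0// -normrZ scalerBr scalerA divff//.
  by rewrite scale1r distrC mulrC.
apply: DeriveDef.
  by apply/cvg_ex; exists v; apply: cvg_ext xt => h; rewrite /= [h%:A]mulr1.
by apply/cvg_lim => //; apply: cvg_ext xt => h; rewrite /= [h%:A]mulr1.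
Unshelve. all: by end_near. Qed.

(** Precomposing with [clamp 0 T] extends a curve on [0, T] by constants, which
    turns continuity on the segment into continuity on the line. *)
Lemma wder_continuous T x (v : R -> V) : 0 <= T ->
  (forall t, 0 <= t <= T -> wder T x t (v t)) -> continuous (x \o clamp 0 T).
Proof.
move=> T0 xv t; apply/cvgrPdist_le => e e0.
set t' := clamp 0 T t.
have t'T : 0 <= t' <= T by exact: clamp_in.
have /wderP/(_ 1 ltr01)[d d0 dP] := xv t' t'T.
near=> s; set s' := clamp 0 T s.
have st : `|s' - t'| <= `|s - t| by exact: clamp_dist.
have sd : `|s - t| < d by rewrite distrC; near: s; exact: cvgr_dist_lt.
have := dP s' (clamp_in _ T0) (le_lt_trans st sd).
rewrite mul1r => H /=; rewrite distrC -/t' -/s'.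
rewrite -(subrK ((s' - t') *: v t') (x s' - x t')).
apply: (le_trans (ler_normD _ _)); rewrite normrZ.
apply: (le_trans (lerD H (lexx _))); rewrite -[X in X + _]mulr1 -mulrDr.
have c0 : 0 < 1 + `|v t'| by rewrite ltr_pwDl.
rewrite -ler_pdivlMr// (le_trans st)// distrC.
by near: s; apply: cvgr_dist_le => //; rewrite divr_gt0.
Unshelve. all: by end_near. Qed.

End TimeDerivative.

(** * Comparison and Gronwall's inequality *)

Section Comparison.
Context {R : realType}.

(** The mean value theorem for [g - h]. *)
Lemma wder_le (T : R) (h g h' g' : R -> R) :
  (forall t, 0 <= t <= T -> wder T h t (h' t)) ->
  (forall t, 0 <= t <= T -> wder T g t (g' t)) ->
  (forall t, 0 <= t <= T -> h' t <= g' t) ->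
  forall t, 0 <= t <= T -> h t - h 0 <= g t - g 0.
Proof.
move=> dh dg hg t /andP[t0 tT]; have T0 := le_trans t0 tT.
pose k s := (g s - h s).
have dk s : 0 <= s <= T -> wder T k s (g' s - h' s).
  by move=> sT; apply: wderB; [exact: dg|exact: dh].
have kc := wder_continuous T0 dk.
have [t0'|/negbTE tn0] := eqVneq t 0; first by rewrite t0' !subrr.
have tp : 0 < t by rewrite lt_neqAle eq_sym tn0.
have [|c|c cin] := @MVT R (k \o clamp 0 T) (fun s => g' s - h' s) 0 t tp.
- move=> s; rewrite in_itv/= => /andP[s0 st].
  have sT : 0 < s < T by rewrite s0 (lt_le_trans st).
  have sT' : 0 <= s <= T by case/andP: sT => /ltW -> /ltW ->.
  apply: wder_is_derive sT _; apply: wder_eq (dk s sT') => // r rT.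
  by rewrite /= clamp_id.
- exact: continuous_subspaceT kc c.
rewrite /= !clamp_id ?lexx ?t0 ?tT//= /k subr0 => kE.
have cT : 0 <= c <= T.
  by move: cin; rewrite in_itv/= => /andP[/ltW -> /ltW ct]; exact: le_trans tT.
have : 0 <= (g' c - h' c) * t by rewrite mulr_ge0// subr_ge0 hg.
by rewrite -kE; lra.
Qed.

(** As the norm is the maximum of the coordinates, it suffices to compare each
    coordinate and its opposite with [g]. *)
Lemma norm_wder_le d (T : R) (f f' : R -> 'rV[R]_d) (g g' : R -> R) :
  (forall t, 0 <= t <= T -> wder T f t (f' t)) ->
  (forall t, 0 <= t <= T -> wder T g t (g' t)) ->
  (forall t, 0 <= t <= T -> `|f' t| <= g' t) ->
  forall t, 0 <= t <= T -> `|f t - f 0| <= g t - g 0.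
Proof.
move=> df dg fg t tT.
have dfj i j s : 0 <= s <= T -> wder T (fun r => f r i j) s (f' s i j).
  move=> sT; apply/wderP => e e0.
  have /wderP/(_ e e0)[r r0 rP] := df s sT; exists r => // q qT qs.
  apply: le_trans (rP q qT qs); apply: le_trans (le_norm_coord _ i j).
  by rewrite !mxE.
have g0 : 0 <= g t - g 0.
  have := @wder_le T (cst 0) g (cst 0) g' _ dg _ t tT; rewrite !fctE subrr; apply.
    by move=> s _; exact: wder_cst.
  by move=> s sT; exact: le_trans (fg s sT).
apply: norm_le_coord => // i j; rewrite !mxE ler_norml; apply/andP; split.
  rewrite lerNl opprB.
  have := @wder_le T (fun r => - f r i j) g (fun s => - f' s i j) g' _ dg _ t tT.
  rewrite opprK addrC; apply=> s sT.
    by have := wderB (wder_cst T 0 s) (dfj i j s sT); rewrite sub0r;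
       apply: wder_eq => // r _; rewrite fctE sub0r.
  by apply: le_trans (fg s sT); apply: le_trans (le_norm_coord _ i j);
     rewrite -normrN ler_norm.
apply: (wder_le (dfj i j) dg) => // s sT; apply: le_trans (fg s sT).
by apply: le_trans (le_norm_coord _ i j); rewrite ler_norm.
Qed.

Lemma is_derive_scale_id (c t : R) : is_derive t 1 (fun s : R => c * s) c.
Proof.
rewrite (_ : (fun s => c * s) = c *: id); last by apply/funext.
by apply: is_derive_eq; rewrite [_ *: _]mulr1.
Qed.

Lemma wder_scale_id (T c t : R) : wder T (fun s => c * s) t c.
Proof. exact/is_derive_wder/is_derive_scale_id. Qed.

Lemma wder_expR (T c K t : R) :
  wder T (fun s => K * expR (c * s)) t (K * c * expR (c * t)).
Proof.
apply: is_derive_wder.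
have H := is_derive1_comp (is_derive_expR (c * t)) (is_derive_scale_id c t).
have := @is_derive1_comp _ _ (expR \o *%R c) t _ _
  (is_derive_scale_id K (expR (c * t))) H.
by rewrite (mulrC (expR _)) mulrA.
Qed.

(** Let [M] be the maximum of [`|y t| * expR (- (2 * L) * t)]. Integrating
    [L * `|y t| <= L * M * expR (2 * L * t)] yields [M / 2 * expR (2 * L * t)],
    so at a point where the maximum is attained half of [M] is absorbed and the
    other half is bounded by the initial value and the forcing term. *)
Lemma gronwall d (T L e : R) (y y' : R -> 'rV[R]_d) :
  0 <= T -> 0 < L -> 0 <= e ->
  (forall t, 0 <= t <= T -> wder T y t (y' t)) ->
  (forall t, 0 <= t <= T -> `|y' t| <= L * `|y t| + e) ->
  forall t, 0 <= t <= T ->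
    `|y t| <= 2 * (`|y 0| + e * T) * expR (2 * L * T).
Proof.
move=> T0 L0 e0 dy yL.
pose w t := `|y (clamp 0 T t)| * expR (- (2 * L) * t).
have wc : continuous w.
  have yc : continuous (y \o clamp 0 T) := wder_continuous T0 dy.
  have nc : continuous (Num.norm \o (y \o clamp 0 T)).
    by move=> t; apply: continuous_comp; [exact: yc|exact: norm_continuous].
  have ec : continuous (expR \o *%R (- (2 * L))).
    by move=> t; apply: continuous_comp; [exact: mulrl_continuous|exact: continuous_expR].
  by move=> t; exact: cvgM (nc t) (ec t).
have [c /[!in_itv]/= cT cmax] := EVT_max T0 (continuous_subspaceT wc (A := `[0, T])).
pose M := w c.
have yM t : 0 <= t <= T -> `|y t| <= M * expR (2 * L * t).
  move=> tT; have := cmax t; rewrite in_itv/= => /(_ tT).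
  rewrite {1}/w clamp_id// mulNr expRN.
  by rewrite ler_pdivrMr ?expR_gt0.
have M0 : 0 <= M by rewrite mulr_ge0// expR_ge0.
have yg t : 0 <= t <= T -> `|y t - y 0| <=
    (M / 2 * expR (2 * L * t) + e * t) - (M / 2 * expR (2 * L * 0) + e * 0).
  have dg s : 0 <= s <= T ->
      wder T (fun s => M / 2 * expR (2 * L * s) + e * s) s
        (M / 2 * (2 * L) * expR (2 * L * s) + e).
    by move=> _; apply: wderD; [exact: wder_expR|exact: wder_scale_id].
  move: t; apply: (norm_wder_le dy dg).
  move=> s sT; apply: (le_trans (yL s sT)); rewrite lerD2r.
  rewrite (_ : M / 2 * (2 * L) * _ = L * (M * expR (2 * L * s))); last by field.
  by rewrite ler_pM2l// yM.
have yb t : 0 <= t <= T -> `|y t| <= `|y 0| + M / 2 * expR (2 * L * t) + e * T.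
  move=> tT; rewrite -(subrK (y 0) (y t)) (le_trans (ler_normD _ _))//.
  have := yg t tT; rewrite mulr0 expR0 mulr0 => H.
  have : e * t <= e * T by rewrite ler_wpM2l//; case/andP: tT.
  have : 0 <= M / 2 by rewrite divr_ge0.
  by lra.
have Mc : M * expR (2 * L * c) = `|y c|.
  by rewrite /M /w clamp_id// mulNr expRN divfK// gt_eqF// expR_gt0.
have M2 : M <= 2 * (`|y 0| + e * T).
  have := yb c cT; rewrite -Mc => H.
  have : M <= M * expR (2 * L * c).
    by rewrite ler_peMr// -expR0 ler_expR; case/andP: cT => c0 _; rewrite !mulr_ge0// ltW.
  lra.
move=> t tT; apply: (le_trans (yM t tT)).
apply: ler_pM; [by []|exact: expR_ge0|by []|].
by rewrite ler_expR ler_pM2l ?mulr_gt0//; case/andP: tT.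
Qed.

End Comparison.

(** * Existence for globally Lipschitz equations *)

Section Picard.
Context {R : realType}.

(** The integral starts at [-1] and the integrand is considered up to [T + 1], so
    that all of [0, T] is interior and the derivative is two-sided there. *)
Lemma antiderivative_real (T : R) (g : R -> R) : 0 <= T -> continuous g ->
  exists2 A : R -> R, A 0 = 0 & forall t, 0 <= t <= T -> is_derive t 1 A (g t).
Proof.
move=> T0 gc; pose mu := @lebesgue_measure R.
pose F x := (\int[mu]_(t in [set` `[-1, x]]) g t).
exists (fun x => F x - F 0); first by rewrite subrr.
move=> t /andP[t0 tT].
have gi : mu.-integrable `[-1, T + 1] (EFin \o g).
  apply: continuous_compact_integrable; first exact: segment_compact.
  exact: continuous_subspaceT.
have tT1 : t < T + 1 by rewrite (le_lt_trans tT)// ltrDl.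
have t1 : -1 < t by rewrite (lt_le_trans _ t0)// ltrN10.
have [dF FE] := continuous_FTC1_closed tT1 gi t1 (gc t).
have H : is_derive t 1 F (g t) by apply: DeriveDef => //; rewrite -derive1E.
have := is_deriveB H (is_derive_cst (F 0) t 1); rewrite subr0.
by rewrite (_ : F - cst (F 0) = (fun x => F x - F 0))//; apply/funext.
Qed.

Lemma antiderivative d (T : R) (g : R -> 'rV[R]_d) : 0 <= T -> continuous g ->
  exists A : R -> 'rV[R]_d,
    A 0 = 0 /\ forall t, 0 <= t <= T -> wder T A t (g t).
Proof.
move=> T0 gc.
have gic i : continuous (fun t => g t 0 i).
  have c : continuous ((fun N : 'rV_d => N 0 i) \o g).
    by move=> t; apply: continuous_comp; [exact: gc|exact: coord_continuous].
  exact: c.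
pose A i := projT1 (cid2 (antiderivative_real T0 (gic i))).
have A0 i : A i 0 = 0 by rewrite /A; case: cid2.
have dA i t : 0 <= t <= T -> is_derive t 1 (A i) (g t 0 i).
  by rewrite /A; case: cid2 => /= B _ dB; exact: dB.
exists (fun t => \row_i A i t); split; first by apply/rowP => i; rewrite !mxE.
move=> t tT; apply/wderP => e e0.
have dAe i : \forall s \near t, 0 <= s <= T ->
    `|A i s - A i t - (s - t) *: g t 0 i| <= e * `|s - t|.
  have /(@is_derive_wder _ _ T)/wderP/(_ e e0)[r r0 rP] := dA i t tT.
  exists r => //= s; rewrite /ball_/= distrC => st sT; exact: rP.
have [r /= r0 rP] := filter_forall (nbhs_filter t) dAe.
exists r => // s sT st; apply: norm_le_coord.
  by rewrite mulr_ge0// ltW.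
move=> i j; rewrite !mxE (ord1 i); apply: rP => //.
by rewrite /ball_/= distrC.
Qed.

Lemma geometric_lt (K e : R) : 0 < e -> exists k, K * 2^-1 ^+ k < e.
Proof.
move=> e0; have h2 : `|2^-1 : R| < 1.
  by rewrite ger0_norm ?invr_ge0// invf_lt1// ltr1n.
have /cvgrPdist_lt/(_ e e0)[k _ kP] := cvg_geometric K h2.
exists k; have := kP k (leqnn k).
by rewrite sub0r normrN; apply: le_lt_trans; exact: ler_norm.
Qed.

Lemma le_geometric0 (K r : R) : (forall k, r <= K * 2^-1 ^+ k) -> r <= 0.
Proof.
move=> H; rewrite leNgt; apply/negP => /(geometric_lt K)[k].
by rewrite ltNge H.
Qed.

Lemma geometric_cauchy d (u : nat -> 'rV[R]_d) (K : R) :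
  (forall k, `|u k.+1 - u k| <= K * 2^-1 ^+ k) ->
  exists l, forall k, `|l - u k| <= 2 * K * 2^-1 ^+ k.
Proof.
move=> uK.
have uKj k j : `|u (k + j)%N - u k| <= 2 * K * (2^-1 ^+ k - 2^-1 ^+ (k + j)).
  elim: j => [|j IH]; first by rewrite addn0 !subrr normr0 mulr0.
  rewrite addnS -(subrK (u (k + j)%N) (u _)) -addrA (le_trans (ler_normD _ _))//.
  apply: (le_trans (lerD (uK _) IH)); rewrite exprS.
  by rewrite le_eqVlt; apply/orP; left; apply/eqP; field.
have K0 : 0 <= K by have := uK 0; rewrite expr0 mulr1; apply: le_trans.
have uKj' k j : (k <= j)%N -> `|u j - u k| <= 2 * K * 2^-1 ^+ k.
  move=> kj; rewrite -(subnKC kj); apply: (le_trans (uKj _ _)).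
  by rewrite ler_wpM2l ?mulr_ge0// lerBlDr lerDl exprn_ge0// invr_ge0.
have uc : cvg (u @ \oo).
  apply/cauchy_cvgP; apply: cauchy_exP => e e0.
  have [k kP] := geometric_lt (2 * K) e0.
  exists (u k); exists k => // j /= kj.
  by rewrite -ball_normE /ball_/= distrC (le_lt_trans (uKj' _ _ kj)).
exists (lim (u @ \oo)) => k.
apply/ler_addgt0Pr => e e0.
have /cvgrPdist_lt/(_ e e0)[N _ NP] := uc.
rewrite -(subrK (u (maxn N k)) (lim _)) -addrA (le_trans (ler_normD _ _))//.
rewrite [leRHS]addrC lerD//; last by rewrite uKj'// leq_maxr.
by rewrite ltW// NP//= leq_maxl.
Qed.

(** Picard iteration.  The iterates are precomposed with [clamp 0 T] to be
    continuous on all of [R]; measured against the weight [expR (2 * L * t)],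
    each integration halves the distance between successive iterates. *)
Lemma picard d (T L : R) (H : R -> 'rV[R]_d -> 'rV[R]_d) (x0 : 'rV[R]_d) :
  0 <= T -> 0 < L ->
  (forall t a b, 0 <= t <= T -> `|H t a - H t b| <= L * `|a - b|) ->
  (forall z : R -> 'rV[R]_d, continuous z -> continuous (fun t => H t (z t))) ->
  exists x, x 0 = x0 /\ forall t, 0 <= t <= T -> wder T x t (H t (x t)).
Proof.
move=> T0 L0 lipH contH.
pose C := {z : R -> 'rV[R]_d | continuous z}.
have stepP (z : C) : exists y : C, [/\ sval y 0 = x0,
    (forall t, sval y t = sval y (clamp 0 T t)) &
    forall t, 0 <= t <= T -> wder T (sval y) t (H t (sval z t))].
  case: z => z zc /=; have [A [A0 dA]] := antiderivative T0 (contH z zc).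
  have dB t : 0 <= t <= T -> wder T (fun s => x0 + A s) t (H t (z t)).
    by move=> tT; have := wderD (wder_cst T x0 t) (dA t tT); rewrite add0r.
  have Bc := wder_continuous T0 dB.
  exists (exist _ _ Bc) => /=; split => [|t|t tT].
  - by rewrite clamp_id ?lexx// A0 addr0.
  - by rewrite (clamp_id (clamp_in t T0)).
  - by apply: wder_eq (dB t tT) => // s sT; rewrite /= clamp_id.
pose step z := projT1 (cid (stepP z)).
have x0c : continuous (cst x0 : R -> 'rV[R]_d) by exact: cst_continuous.
pose u k : C := iter k step (exist _ (cst x0) x0c).
have uS k : [/\ sval (u k.+1) 0 = x0,
    (forall t, sval (u k.+1) t = sval (u k.+1) (clamp 0 T t)) &
    forall t, 0 <= t <= T -> wder T (sval (u k.+1)) t (H t (sval (u k) t))].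
  by rewrite /= /step; case: cid.
have u0 k : sval (u k) 0 = x0 by case: k => [//|k]; have [] := uS k.
have uclamp k t : sval (u k) t = sval (u k) (clamp 0 T t).
  by case: k => [//|k]; have [] := uS k.
have uc k : continuous (sval (u k)) := svalP (u k).
have [K K0 K1] : exists2 K, 0 <= K & forall t, 0 <= t <= T ->
    `|sval (u 1) t - sval (u 0) t| <= K.
  have nc : continuous (Num.norm \o (fun t => sval (u 1) t - sval (u 0) t)).
    move=> t; apply: continuous_comp; last exact: norm_continuous.
    exact: cvgB (uc 1 t) (uc 0 t).
  have [c _ cmax] := EVT_max T0 (continuous_subspaceT nc (A := `[0, T])).
  by exists (`|sval (u 1) c - sval (u 0) c|).
have uK k t : 0 <= t <= T -> `|sval (u k.+1) t - sval (u k) t| <=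
    K * 2^-1 ^+ k * expR (2 * L * t).
  elim: k t => [|k IH] t tT.
    rewrite expr0 mulr1 (le_trans (K1 t tT))// ler_peMr// -expR0 ler_expR.
    by case/andP: tT => ? _; rewrite !mulr_ge0// ltW.
  have dk s : 0 <= s <= T -> wder T (fun r => sval (u k.+2) r - sval (u k.+1) r) s
      (H s (sval (u k.+1) s) - H s (sval (u k) s)).
    have [_ _ d1] := uS k; have [_ _ d2] := uS k.+1.
    by move=> sT; apply: wderB; [exact: d2|exact: d1].
  have := norm_wder_le dk (fun s _ => @wder_expR _ T (2 * L) (K * 2^-1 ^+ k.+1) s).
  move=> /(_ _ t tT); rewrite !u0 subrr subr0 => /(_ _)/le_trans; apply.
    move=> s sT; apply: (le_trans (lipH _ _ _ sT)).
    rewrite (_ : _ * expR _ = L * (K * 2^-1 ^+ k * expR (2 * L * s))).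
      by rewrite ler_pM2l// IH.
    by rewrite exprS; field.
  rewrite lerBlDr lerDl !mulr_ge0// ?expR_ge0// exprn_ge0// invr_ge0//.
pose K' := K * expR (2 * L * T).
have uK' t k : `|sval (u k.+1) t - sval (u k) t| <= K' * 2^-1 ^+ k.
  rewrite (uclamp k.+1) (uclamp k); have tT := clamp_in t T0.
  apply: (le_trans (uK k _ tT)); rewrite /K' mulrAC ler_wpM2r//.
  by rewrite ler_wpM2l// ler_expR ler_pM2l ?mulr_gt0//; case/andP: tT.
pose z t := projT1 (cid (geometric_cauchy (uK' t))).
have zu t k : `|z t - sval (u k) t| <= 2 * K' * 2^-1 ^+ k.
  by rewrite /z; case: cid => /= l lP; exact: lP.
have zc : continuous z.
  move=> t; apply/cvgrPdist_le => e e0.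
  have e3 : 0 < e / 3 by rewrite divr_gt0.
  have [k kP] := geometric_lt (2 * K') e3.
  near=> s.
  have : `|sval (u k) t - sval (u k) s| <= e / 3.
    near: s; have /cvgrPdist_le := uc k t; exact.
  have := zu t k; have := zu s k; rewrite (distrC (z s)).
  have -> : z t - z s = (z t - sval (u k) t) + ((sval (u k) t - sval (u k) s) +
    (sval (u k) s - z s)) by rewrite -!addrA !addKr.
  move=> h1 h2 h3; apply: (le_trans (ler_normD _ _)).
  have := ler_normD (sval (u k) t - sval (u k) s) (sval (u k) s - z s).
  by move: kP e0; lra.
have [A [A0 dA]] := antiderivative T0 (contH z zc).
pose x t := x0 + A t.
have dx t : 0 <= t <= T -> wder T x t (H t (z t)).
  by move=> tT; have := wderD (wder_cst T x0 t) (dA t tT); rewrite add0r.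
(* [x] and the next iterate are integrals along [z] and the current iterate, so
   they too differ by a geometrically small error. *)
have xE t : 0 <= t <= T -> x t = z t.
  move=> tT; apply/eqP; rewrite -subr_eq0 -normr_le0.
  apply: (@le_geometric0 (L * (2 * K') * T + 2 * K')) => k.
  have dk s : 0 <= s <= T -> wder T (fun r => x r - sval (u k.+1) r) s
      (H s (z s) - H s (sval (u k) s)).
    have [_ _ d1] := uS k.
    by move=> sT; apply: wderB; [exact: dx|exact: d1].
  have := norm_wder_le dk
    (fun s _ => @wder_scale_id _ T (L * (2 * K' * 2^-1 ^+ k)) s).
  move=> /(_ _ t tT); rewrite u0 {2}/x A0 addr0 subrr subr0 mulr0 subr0 => H1.
  have {}H1 := H1 (fun s sT => le_trans (lipH s _ _ sT)
    (ler_wpM2l (ltW L0) (zu s k))).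
  have := zu t k.+1; rewrite exprS distrC => H2.
  have -> : x t - z t = (x t - sval (u k.+1) t) + (sval (u k.+1) t - z t).
    by rewrite addrA subrK.
  apply: (le_trans (ler_normD _ _)).
  apply: (le_trans (lerD H1 H2)).
  have K'0 : 0 <= K' by rewrite mulr_ge0// expR_ge0.
  have h2 : 0 <= 2^-1 ^+ k :> R by rewrite exprn_ge0// invr_ge0.
  have : L * (2 * K' * 2^-1 ^+ k) * t <= L * (2 * K' * 2^-1 ^+ k) * T.
    by case/andP: tT => _ tT; rewrite ler_wpM2l// !mulr_ge0// ltW.
  have : 0 <= K' * 2^-1 ^+ k by rewrite mulr_ge0.
  rewrite !mulrDl; lra.
exists x; split; first by rewrite /x A0 addr0.
by move=> t tT; rewrite xE//; exact: dx.
Unshelve. all: by end_near. Qed.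

End Picard.

(** * Uniform linearization along a compact trajectory *)

Section Jacobian.
Context {R : realType} {p q : nat}.
Implicit Types (G : 'rV[R]_p -> 'rV[R]_q) (Omega : set 'rV[R]_p).

Lemma jacobianE G z i j : differentiable G z ->
  'J G z i j = 'D_(delta_mx 0 i) G z 0 j.
Proof. by move=> dG; rewrite deriveE// /jacobian mxE. Qed.

Lemma jacobian_continuous Omega G : open Omega -> class_C 1 Omega G ->
  forall z, Omega z -> {for z, continuous (jacobian G)}.
Proof.
move=> oO [dG cG] z Oz; move: (jacobian G) (@jacobianE G) => J JE.
apply: near_dist_continuous => e e0.
have cGi i : \forall y \near z, `|'D_(delta_mx 0 i) G z - 'D_(delta_mx 0 i) G y| <= e.
  exact: continuous_near_dist (cG _ z Oz) e0.
have nO : \forall y \near z, Omega y by exact: open_nbhs_nbhs.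
have nG := filter_forall (nbhs_filter z) cGi.
near=> y.
have Oy : Omega y by near: y.
have H i : `|'D_(delta_mx 0 i) G z - 'D_(delta_mx 0 i) G y| <= e.
  by move: i; near: y.
apply: norm_subr_le_coord => [|i j]; first exact: ltW.
rewrite (JE z) ?(JE y); [|exact: dG|exact: dG].
by apply: le_trans (H i); exact: le_norm_subr_coord.
Unshelve. all: by end_near. Qed.

Lemma derive_line G (a v : 'rV[R]_p) (s : R) : differentiable G (a + s *: v) ->
  is_derive s 1 (fun r => G (a + r *: v)) (v *m 'J G (a + s *: v)).
Proof.
move=> dG; pose h r := a + r *: v.
have dh : is_diff s h ((fun _ => 0) + *:%R ^~ v).
  have := is_diffD (is_diff_cst a s) (is_diff_scalel s v).
  by [].
have dhs : differentiable h s by exact: ex_diff.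
have dGh : differentiable (G \o h) s by exact: differentiable_comp.
apply: DeriveDef; first exact/derivable1_diffP.
rewrite -deriveEjacobian// (deriveE _ dG) (deriveE _ dGh) diff_comp//=.
by congr ('d G _ _); rewrite (@diff_val _ _ _ _ _ _ _ dh)/= fctE add0r scale1r.
Qed.

(** The curve [G (c + a + s *: (b - a)) - s *: ((b - a) *m A)] has a derivative
    bounded by the oscillation of the Jacobian around [A]. *)
Lemma mean_value_ball Omega G (c : 'rV[R]_p) (A : 'M[R]_(p, q)) (delta eta : R) :
  (forall z, Omega z -> differentiable G z) -> 0 <= eta ->
  (forall a : 'rV[R]_p, `|a| <= delta -> Omega (c + a) /\ `|'J G (c + a) - A| <= eta) ->
  forall a b : 'rV[R]_p, `|a| <= delta -> `|b| <= delta ->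
    `|G (c + b) - G (c + a) - (b - a) *m A| <= p%:R * eta * `|b - a|.
Proof.
move=> dG eta0 H a b ad bd.
have ab s : 0 <= s <= 1 -> `|a + s *: (b - a)| <= delta.
  move=> /andP[s0 s1].
  have -> : a + s *: (b - a) = (1 - s) *: a + s *: b.
    by rewrite scalerBr scalerBl scale1r addrA addrAC.
  apply: (le_trans (ler_normD _ _)); rewrite !normrZ !ger0_norm ?subr_ge0//.
  have h1 : (1 - s) * `|a| <= (1 - s) * delta by rewrite ler_wpM2l// subr_ge0.
  have h2 : s * `|b| <= s * delta by rewrite ler_wpM2l.
  by lra.
pose f s := G (c + a + s *: (b - a)) - s *: ((b - a) *m A).
have df s : 0 <= s <= 1 ->
    wder 1 f s ((b - a) *m ('J G (c + a + s *: (b - a)) - A)).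
  move=> s01; rewrite mulmxBr; apply: wderB; apply: is_derive_wder.
    by apply: derive_line; apply: dG; rewrite -addrA; case: (H _ (ab s s01)).
  apply: DeriveDef; first exact/derivable1_diffP.
  by rewrite deriveE// diff_val scale1r.
have := norm_wder_le df (fun s _ => @wder_scale_id _ 1 (p%:R * eta * `|b - a|) s).
move=> /(_ _ 1); rewrite ler01 lexx => /(_ _ isT).
rewrite /f !scale1r !scale0r !addr0 subr0 mulr1 mulr0 subr0.
rewrite -[c + a + _]addrA [a + _]addrC subrK addrAC; apply=> s s01.
apply: (le_trans (norm_mulmx_le _ _)); rewrite ler_wpM2r// ler_wpM2l//.
by rewrite -addrA; case: (H _ (ab s s01)).
Qed.

(** Continuity of the Jacobian on a neighbourhood of a compact set, with a modulus
    that is uniform over the compact set. *)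
Lemma compact_jacobian_uniform Omega G K (eta : R) :
  open Omega -> class_C 1 Omega G -> compact K -> K `<=` Omega -> 0 < eta ->
  exists2 delta, 0 < delta & forall z a : 'rV[R]_p, K z -> `|a| <= delta ->
    Omega (z + a) /\ `|'J G (z + a) - 'J G z| <= eta.
Proof.
move=> oO cG /compact_near_coveringP cK KO eta0.
have := jacobian_continuous oO cG; move: (jacobian G) => J Jc.
pose P (delta : R) (z : 'rV[R]_p) := forall a : 'rV[R]_p, `|a| <= delta ->
  Omega (z + a) /\ `|J (z + a) - J z| <= eta.
have : \forall delta \near (0 : R)^'+, K `<=` P delta.
  apply: cK => z0 Kz0; have Oz0 := KO _ Kz0.
  have e2 : 0 < eta / 2 by rewrite divr_gt0.
  have Jz0 := continuous_near_dist (Jc _ Oz0) e2.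
  have Oy : nbhs z0 Omega by exact: open_nbhs_nbhs.
  have [r /= r0 rP] := (nbhs_ballP _ _).1 (filterI Oy Jz0).
  have r2 : 0 < r / 2 by rewrite divr_gt0.
  have z0r : \forall z \near z0, `|z0 - z| < r / 2.
    exact: near_dist_lt.
  near=> z delta => a ad.
  have zr : `|z0 - z| < r / 2 by near: z.
  have dr : delta < r / 2 by near: delta; exact: nbhs_right_lt.
  have B y : `|z0 - y| < r -> Omega y /\ `|J z0 - J y| <= eta / 2.
    by move=> yr; apply: rP; rewrite -ball_normE.
  have [] := B (z + a).
    rewrite opprD addrA (le_lt_trans (ler_normB _ _))// [r]splitr ltrD//.
    exact: le_lt_trans ad dr.
  have [|_ Jz] := B z; first by rewrite (lt_le_trans zr)// ler_pdivrMr// ler_pMr// ler1n.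
  move=> Oza Jza; split=> //.
  rewrite distrC -(subrK (J z0) (J z)) -addrA (le_trans (ler_normD _ _))//.
  by rewrite [eta]splitr; apply: lerD; [rewrite distrC|].
move=> H; near (0 : R)^'+ => delta; exists delta; first by near: delta; exact: nbhs_right_gt.
move=> z a Kz; have : K `<=` P delta by near: delta.
by move=> /(_ z Kz a).
Unshelve. all: by end_near. Qed.

End Jacobian.

Section Tube.
Context {R : realType} {p q : nat}.
Variables (Omega : set 'rV[R]_p) (G : 'rV[R]_p -> 'rV[R]_q).
Variables (T : R) (x : R -> 'rV[R]_p).
Hypotheses (oO : open Omega) (cG : class_C 1 Omega G) (T0 : 0 <= T).
Hypotheses (xc : continuous (x \o clamp 0 T))
  (xO : forall t, 0 <= t <= T -> Omega (x t)).

(** For every precision [eta] there is a tube of constant width around the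
    trajectory on which [G] is, uniformly in time, that close to its linearization
    along the trajectory. All estimates on neighbouring solutions rest on this. *)
Lemma tube eta : 0 < eta ->
  exists2 delta, 0 < delta & forall t (a b : 'rV[R]_p), 0 <= t <= T ->
    `|a| <= delta -> `|b| <= delta ->
    [/\ Omega (x t + a), `|'J G (x t + a) - 'J G (x t)| <= eta &
        `|G (x t + b) - G (x t + a) - (b - a) *m 'J G (x t)| <= eta * `|b - a|].
Proof.
move=> eta0; pose K := (x \o clamp 0 T) @` `[0, T].
have cK : compact K.
  apply: continuous_compact; last exact: segment_compact.
  exact: continuous_subspaceT.
have KO : K `<=` Omega.
  by move=> _ [t _ <-]; apply: xO; exact: clamp_in.
have eta1 : 0 < eta / p.+1%:R by rewrite divr_gt0.
have [delta d0 dP] := compact_jacobian_uniform oO cG cK KO eta1.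
exists delta => // t a b tT ad bd.
have Kx : K (x t) by exists t; rewrite /= ?in_itv//= clamp_id.
have p1 : p%:R * (eta / p.+1%:R) <= eta.
  rewrite mulrCA; apply: ler_piMr; first exact: ltW.
  by rewrite ler_pdivrMr// mul1r ler_nat.
have [Oa Ja] := dP _ _ Kx ad; split=> //.
  apply: (le_trans Ja); rewrite ler_pdivrMr//; apply: ler_peMr; first exact: ltW.
  by rewrite ler1n.
have := mean_value_ball cG.1 (ltW eta1) (fun a => dP _ a Kx) ad bd.
by move=> /le_trans; apply; rewrite ler_wpM2r.
Qed.

Lemma jacobian_path_continuous : continuous (jacobian G \o (x \o clamp 0 T)).
Proof.
move=> t; apply: continuous_comp; first exact: xc.
by apply: (jacobian_continuous oO cG); apply: xO; exact: clamp_in.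
Qed.

Lemma jacobian_path_bounded : exists2 B : R, 0 < B &
  forall t (h : 'rV[R]_p), 0 <= t <= T -> `|h *m 'J G (x t)| <= B * `|h|.
Proof.
move: (jacobian G) jacobian_path_continuous => J Jc.
have nc : continuous (Num.norm \o (J \o (x \o clamp 0 T))).
  by move=> t; apply: continuous_comp; [exact: Jc|exact: norm_continuous].
have [c _ cmax] := EVT_max T0 (continuous_subspaceT nc (A := `[0, T])).
exists (p%:R * `|J (x (clamp 0 T c))| + 1).
  by rewrite ltr_wpDl// mulr_ge0.
move=> t h tT; apply: (le_trans (norm_mulmx_le _ _)); apply: ler_wpM2r => //.
apply: ler_wpDr => //; apply: ler_wpM2l => //.
by have := cmax t; rewrite in_itv/= clamp_id//; exact.
Qed.

End Tube.

(** * The flow: uniqueness, open domain, variational equation *)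

Section FlowDef.
Context {R : realType} {d : nat}.
Variables (Omega : set 'rV[R]_d) (G : 'rV[R]_d -> 'rV[R]_d) (T : R).

Definition flow_solution (z : 'rV[R]_d) (x : R -> 'rV[R]_d) : Prop :=
  x 0 = z /\ forall t, 0 <= t <= T -> Omega (x t) /\ wder T x t (G (x t)).

Definition flow_domain : set 'rV[R]_d :=
  [set z | exists x, flow_solution z x].

Definition flow (z : 'rV[R]_d) : 'rV[R]_d :=
  xget 0 [set y | exists2 x, flow_solution z x & x T = y].

(** [M t] is the derivative at time [t] along [x] with respect to the initial
    value: row vectors [v *m M t] solve the variational equation
    [w' = w *m 'J G (x t)]. *)
Definition fundamental (x : R -> 'rV[R]_d) (M : R -> 'M[R]_d) : Prop :=
  M 0 = 1%:M /\ forall (v : 'rV[R]_d) t, 0 <= t <= T ->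
    wder T (fun s => v *m M s) t (v *m M t *m 'J G (x t)).

End FlowDef.

Section ClampVector.
Context {R : realType} {d : nat}.

(** A retraction onto the ball of radius [delta] for the maximum norm; it is
    1-Lipschitz because it acts on each coordinate separately. *)
Definition clampv (delta : R) (v : 'rV[R]_d) : 'rV[R]_d :=
  \row_i clamp (- delta) delta (v 0 i).

Lemma clampv_le delta v : 0 <= delta -> `|clampv delta v| <= delta.
Proof.
move=> d0; apply: norm_le_coord => // i j; rewrite mxE ler_norml clamp_in//.
by rewrite ge0_cp.
Qed.

Lemma clampv_id delta v : `|v| <= delta -> clampv delta v = v.
Proof.
move=> vd; apply/rowP => i; rewrite mxE clamp_id// -ler_norml.
exact: le_trans (le_norm_coord _ _ _) vd.
Qed.

Lemma clampv_dist delta v w : `|clampv delta v - clampv delta w| <= `|v - w|.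
Proof.
apply: norm_le_coord => // i j; rewrite !mxE (le_trans (clamp_dist _ _ _ _))//.
by have := le_norm_coord (v - w) 0 j; rewrite !mxE.
Qed.

Lemma clampv_continuous delta : continuous (clampv delta).
Proof.
move=> v; apply: near_dist_continuous => e e0.
have ve := near_dist_lt (v : 'rV[R]_d) e0.
by near=> w; apply: (le_trans (clampv_dist _ _ _)); apply/ltW; near: w.
Unshelve. all: by end_near. Qed.

End ClampVector.

Lemma mulmx_path_continuous (R : realType) p q (z : R -> 'rV[R]_p)
    (A : R -> 'M[R]_(p, q)) :
  continuous z -> continuous A -> continuous (fun t => z t *m A t).
Proof.
move=> zc Ac t; apply: near_dist_continuous => e e0.
pose c := p%:R * (`|A t| + 1) + p%:R * `|z t| + 1.
have c0 : 0 < c by rewrite ltr_wpDl// addr_ge0// mulr_ge0// addr_ge0.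
have ec : 0 < e / c by rewrite divr_gt0.
near=> s.
have zs : `|z t - z s| <= e / c by near: s; exact: continuous_near_dist (zc t) ec.
have As : `|A t - A s| <= e / c by near: s; exact: continuous_near_dist (Ac t) ec.
have As1 : `|A t - A s| <= 1 by near: s; exact: continuous_near_dist (Ac t) ltr01.
have AsB : `|A s| <= `|A t| + 1.
  rewrite -(subrK (A t) (A s)) (le_trans (ler_normD _ _))// addrC lerD2l.
  by rewrite distrC.
have -> : z t *m A t - z s *m A s = (z t - z s) *m A s + z t *m (A t - A s).
  by rewrite mulmxBl mulmxBr [RHS]addrC addrA subrK.
apply: (le_trans (ler_normD _ _)).
apply: (le_trans (lerD (norm_mulmx_le _ _) (norm_mulmx_le _ _))).
have h1 : p%:R * `|A s| * `|z t - z s| <= p%:R * (`|A t| + 1) * (e / c).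
  by apply: ler_pM => //; rewrite ?mulr_ge0// ler_wpM2l.
have h2 : p%:R * `|A t - A s| * `|z t| <= p%:R * `|z t| * (e / c).
  by rewrite mulrAC ler_wpM2l// mulr_ge0.
apply: (le_trans (lerD h1 h2)); rewrite -mulrDl.
rewrite mulrCA ger_pMr// ler_pdivrMr// mul1r /c.
by rewrite lerDl.
Unshelve. all: by end_near. Qed.

Section Flow.
Context {R : realType} {d : nat}.
Variables (Omega : set 'rV[R]_d) (G : 'rV[R]_d -> 'rV[R]_d) (T : R).
Hypotheses (oO : open Omega) (cG : class_C 1 Omega G) (T0 : 0 <= T).
Local Notation solution := (flow_solution Omega G T).

Lemma flow_solution_continuous z x : solution z x -> continuous (x \o clamp 0 T).
Proof.
move=> [_ xP]; apply: (@wder_continuous _ _ T x (fun t => G (x t)) T0) => t tT.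
by have [] := xP t tT.
Qed.

Lemma vector_field_continuous (y : R -> 'rV[R]_d) :
  continuous y -> (forall t, Omega (y t)) -> continuous (G \o y).
Proof.
move=> yc yO t; apply: continuous_comp; first exact: yc.
exact: (class_C_continuous cG).
Qed.

(** [G] is only known to be Lipschitz on a tube around [x], which [y] might leave.
    But outside it the solutions are at distance more than [delta], so a bound [M]
    on the difference of velocities is a Lipschitz bound with constant
    [M / delta]; hence Gronwall applies on the whole of [0, T]. *)
Lemma flow_unique z x y : solution z x -> solution z y ->
  forall t, 0 <= t <= T -> x t = y t.
Proof.
move=> sx sy t tT; have xc := flow_solution_continuous sx.
have yc := flow_solution_continuous sy; have [x0 xP] := sx; have [y0 yP] := sy.
have xO s (sT : 0 <= s <= T) := proj1 (xP s sT).
have yO s (sT : 0 <= s <= T) := proj1 (yP s sT).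
have [delta d0 dP] := tube oO cG T0 xc xO ltr01.
have [B B0 BP] := jacobian_path_bounded oO cG T0 xc xO.
have nc : continuous (Num.norm \o
    (fun s => (G \o (y \o clamp 0 T)) s - (G \o (x \o clamp 0 T)) s)).
  move=> s; apply: continuous_comp; last exact: norm_continuous.
  apply: (cvgB (F := nbhs s)); apply: vector_field_continuous => // r.
    by apply: yO; exact: clamp_in.
  by apply: xO; exact: clamp_in.
have [c _ cmax] := EVT_max T0 (continuous_subspaceT nc (A := `[0, T])).
set M := (Num.norm \o _) c in cmax.
have M0 : 0 <= M by exact: normr_ge0.
have MP s : 0 <= s <= T -> `|G (y s) - G (x s)| <= M.
  by move=> sT; have := cmax s; rewrite in_itv/= !clamp_id//; exact.
pose L := B + 1 + M / delta.
have L0 : 0 < L by rewrite ltr_wpDr ?addr_gt0// divr_ge0// ltW.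
have GL s : 0 <= s <= T -> `|G (y s) - G (x s)| <= L * `|y s - x s| + 0.
  move=> sT; rewrite addr0; have [near|far] := leP `|y s - x s| delta.
    have cd0 : `|0 : 'rV[R]_d| <= delta by rewrite normr0 ltW.
    have [_ _] := dP s 0 (y s - x s) sT cd0 near.
    rewrite addr0 subr0 mul1r (addrC (x s)) subrK => H.
    rewrite -(subrK ((y s - x s) *m 'J G (x s)) (G _ - _)).
    apply: (le_trans (ler_normD _ _)); apply: (le_trans (lerD H (BP s _ sT))).
    have : 0 <= M / delta * `|y s - x s| by rewrite mulr_ge0// divr_ge0// ltW.
    by rewrite /L; lra.
  (* Outside the tube, the bound on the velocities serves as Lipschitz bound. *)
  apply: (le_trans (MP s sT)).
  have : M <= M / delta * `|y s - x s|.
    by rewrite -mulrA ler_peMr// ler_pdivlMl// mulr1 ltW.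
  have : 0 <= B * `|y s - x s| by rewrite mulr_ge0// ltW.
  have : 0 <= `|y s - x s| by [].
  by rewrite /L; lra.
have dyx s : 0 <= s <= T -> wder T (fun r => y r - x r) s (G (y s) - G (x s)).
  by move=> sT; apply: wderB; [exact: (yP s sT).2|exact: (xP s sT).2].
have := gronwall T0 L0 (lexx 0) dyx GL tT.
rewrite x0 y0 subrr normr0 mul0r addr0 mulr0 mul0r normr_le0 subr_eq0.
by move/eqP.
Qed.

(** Retracting onto a tube around [x] makes the vector field globally Lipschitz,
    so the retracted equation has a solution from every initial value. By Gronwall
    a solution that starts close to [z] stays in the tube, where the retraction is
    the identity: it solves the original equation. *)
Lemma flow_nearby z x : solution z x ->
  exists C delta, [/\ 0 < C, 0 < delta & forall z' : 'rV[R]_d, `|z' - z| <= delta ->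
    exists y, solution z' y /\
      forall t, 0 <= t <= T -> `|y t - x t| <= C * `|z' - z|].
Proof.
move=> sx; have xc := flow_solution_continuous sx; have [x0 xP] := sx.
have xO s (sT : 0 <= s <= T) := proj1 (xP s sT).
have [delta d0 dP] := tube oO cG T0 xc xO ltr01.
have [B B0 BP] := jacobian_path_bounded oO cG T0 xc xO.
pose H t (v : 'rV[R]_d) := G (x (clamp 0 T t) + clampv delta (v - x (clamp 0 T t))).
have L0 : 0 < B + 1 by rewrite addr_gt0.
have cd (v : 'rV[R]_d) : `|clampv delta v| <= delta by rewrite clampv_le// ltW.
have lipH t a b : 0 <= t <= T -> `|H t a - H t b| <= (B + 1) * `|a - b|.
  move=> tT; rewrite /H clamp_id//; set a' := clampv _ _; set b' := clampv _ _.
  have [_ _ GH] := dP t b' a' tT (cd _) (cd _).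
  rewrite -(subrK ((a' - b') *m 'J G (x t)) (G _ - _)).
  apply: (le_trans (ler_normD _ _)); apply: (le_trans (lerD GH (BP t _ tT))).
  rewrite -mulrDl addrC ler_pM2l//.
  apply: (le_trans (clampv_dist _ _ _)).
  by rewrite opprB addrA subrK.
have contH v : continuous v -> continuous (fun t => H t (v t)).
  move=> vc; pose p := fun t => (x \o clamp 0 T) t +
    clampv delta (v t - (x \o clamp 0 T) t).
  have pc : continuous p.
    have kc : continuous (clampv delta \o (fun t => v t - (x \o clamp 0 T) t)).
      move=> t; apply: continuous_comp; last exact: clampv_continuous.
      exact: (cvgB (vc t) (xc t)).
    by move=> t; exact: (cvgD (xc t) (kc t)).
  apply: (vector_field_continuous pc) => t.
  set v' := v t - (x \o clamp 0 T) t.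
  by case: (dP _ _ _ (clamp_in t T0) (cd v') (cd v')).
pose C := 2 * expR (2 * (B + 1) * T).
have C0 : 0 < C by rewrite mulr_gt0// expR_gt0.
exists C, (delta / C); split=> //; first by rewrite divr_gt0.
move=> z' zz'; have [y [y0 dy]] := picard z' T0 L0 lipH contH.
have Hx t : 0 <= t <= T -> H t (x t) = G (x t).
  move=> tT; rewrite /H clamp_id// subrr clampv_id ?normr0 ?addr0// ltW//.
have dyx t : 0 <= t <= T -> wder T (fun s => y s - x s) t (H t (y t) - G (x t)).
  by move=> tT; apply: wderB; [exact: dy|exact: (xP t tT).2].
have yxL t : 0 <= t <= T -> `|H t (y t) - G (x t)| <= (B + 1) * `|y t - x t| + 0.
  by move=> tT; rewrite addr0 -Hx//; exact: lipH.
have yx t : 0 <= t <= T -> `|y t - x t| <= C * `|z' - z|.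
  move=> tT; have := gronwall T0 L0 (lexx 0) dyx yxL tT.
  by rewrite x0 y0 mul0r addr0 mulrAC.
exists y; split=> //; split=> // t tT.
have yd : `|y t - x t| <= delta.
  by apply: (le_trans (yx t tT)); rewrite mulrC -ler_pdivlMr.
have Hy : H t (y t) = G (y t).
  by rewrite /H clamp_id// clampv_id// addrC subrK.
split; last by rewrite -Hy; exact: dy.
by have [] := dP t _ _ tT yd yd; rewrite (addrC (x t)) subrK.
Qed.

Lemma flow_domain_open : open (flow_domain Omega G T).
Proof.
rewrite openE => z [x sx]; have [C [delta [C0 d0 H]]] := flow_nearby sx.
apply/nbhs_ballP; exists delta => //= z'; rewrite -ball_normE /ball_/= => zz'.
have [|y [sy _]] := H z'; first by rewrite distrC ltW.
by exists y.
Qed.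

Lemma flowE z x : solution z x -> flow Omega G T z = x T.
Proof.
move=> sx; rewrite /flow; case: xgetP => [y _ [x' sx' <-]|/(_ (x T))]; last first.
  by case; exists x.
by apply: (flow_unique sx' sx); rewrite lexx T0.
Qed.

(** The rows of [M] solve the variational equation from the vectors of the
    canonical basis; a global solution exists because the equation is linear. *)
Lemma fundamental_matrix z x : solution z x ->
  exists M : R -> 'M[R]_d, fundamental G T x M.
Proof.
move=> sx; have xc := flow_solution_continuous sx; have [x0 xP] := sx.
have xO s (sT : 0 <= s <= T) := proj1 (xP s sT).
have [B B0 BP] := jacobian_path_bounded oO cG T0 xc xO.
pose H t (v : 'rV[R]_d) := v *m 'J G (x (clamp 0 T t)).
have lipH t a b : 0 <= t <= T -> `|H t a - H t b| <= B * `|a - b|.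
  by move=> tT; rewrite /H clamp_id// -mulmxBl BP.
have contH v : continuous v -> continuous (fun t => H t (v t)).
  move=> vc; apply: mulmx_path_continuous => //.
  exact: jacobian_path_continuous xc xO.
pose w j := projT1 (cid (picard (delta_mx 0 j) T0 B0 lipH contH)).
have w0 j : w j 0 = delta_mx 0 j by rewrite /w; case: cid => /= ? [].
have dw j t : 0 <= t <= T -> wder T (w j) t (w j t *m 'J G (x t)).
  move=> tT; rewrite /w; case: cid => /= y [_ /(_ t tT)].
  by rewrite /H clamp_id.
exists (fun t => \matrix_j w j t); split.
  by apply/row_matrixP => j; rewrite rowK w0 row1.
move=> v t tT.
have mE s : v *m (\matrix_j w j s) = \sum_j v 0 j *: w j s.
  by rewrite mulmx_sum_row; apply: eq_bigr => j _; rewrite rowK.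
rewrite mE mulmx_suml (_ : (fun s => _) = (fun s => \sum_j v 0 j *: w j s)).
  apply: wder_sum => j; rewrite -scalemxAl.
  exact: (wder_linear (A := *:%R (v 0 j)) (@scaler_continuous _ _ (v 0 j))) (dw j t tT).
by apply/funext => s; exact: mE.
Qed.

End Flow.

(** * Smoothness of the flow *)

Section FlowSmooth.
Context {R : realType} {d : nat}.
Variables (Omega : set 'rV[R]_d) (G : 'rV[R]_d -> 'rV[R]_d) (T : R).
Hypotheses (oO : open Omega) (cG : class_C 1 Omega G) (T0 : 0 <= T).
Local Notation solution := (flow_solution Omega G T).
Local Notation fundamental := (fundamental G T).

(** The remainder [y - x - h *m M] solves the variational equation up to the
    linearization error of [G], which the tube makes at most [eta * C * `|h|];
    Gronwall turns this into the bound [e * `|h|] at time [T]. *)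
Lemma flow_first_order z x M e : solution z x -> fundamental x M -> 0 < e ->
  exists2 delta, 0 < delta & forall h : 'rV[R]_d, `|h| <= delta ->
    exists2 y, solution (h + z) y & `|y T - x T - h *m M T| <= e * `|h|.
Proof.
move=> sx [M0 dM] e0; have xc := flow_solution_continuous T0 sx.
have [x0 xP] := sx.
have xO s (sT : 0 <= s <= T) := proj1 (xP s sT).
have [B B0 BP] := jacobian_path_bounded oO cG T0 xc xO.
have [C [delta0 [C0 d00 H]]] := flow_nearby oO cG T0 sx.
(* [E * eta] is the constant that Gronwall's estimate produces below. *)
pose E := 2 * C * T * expR (2 * B * T).
have E0 : 0 <= E by rewrite !mulr_ge0// ?expR_ge0// ltW.
have E1 : 0 < E + 1 by rewrite ltr_wpDl.
pose eta := e / (E + 1).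
have eta0 : 0 < eta by rewrite divr_gt0.
have [delta1 d10 dP] := tube oO cG T0 xc xO eta0.
exists (Num.min delta0 (delta1 / C)).
  by rewrite lt_min d00 divr_gt0.
move=> h; rewrite le_min ler_pdivlMr// => /andP[h0 h1].
have hz : h + z - z = h by rewrite addrK.
have [|y [sy yx]] := H (h + z); first by rewrite hz.
exists y => //; have [y0 yP] := sy.
pose r t := y t - x t - h *m M t.
pose r' t := G (y t) - G (x t) - h *m M t *m 'J G (x t).
have dr t : 0 <= t <= T -> wder T r t (r' t).
  move=> tT; apply: wderB; last exact: dM.
  by apply: wderB; [exact: (yP t tT).2|exact: (xP t tT).2].
have rB t : 0 <= t <= T -> `|r' t| <= B * `|r t| + eta * (C * `|h|).
  move=> tT; have := yx t tT; rewrite hz => yxt.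
  have yd : `|y t - x t| <= delta1 by apply: (le_trans yxt); rewrite mulrC.
  have cd0 : `|0 : 'rV[R]_d| <= delta1 by rewrite normr0 ltW.
  have [_ _] := dP t 0 (y t - x t) tT cd0 yd.
  rewrite addr0 subr0 (addrC (x t)) subrK => Gyx.
  have -> : r' t = (G (y t) - G (x t) - (y t - x t) *m 'J G (x t)) +
      r t *m 'J G (x t).
    by rewrite [in RHS]/r [(_ - h *m M t) *m _]mulmxBl addrA subrK.
  apply: (le_trans (ler_normD _ _)); rewrite addrC lerD ?BP//.
  by apply: (le_trans Gyx); rewrite ler_wpM2l// ltW.
have C1 : 0 <= eta * (C * `|h|) by rewrite mulr_ge0 ?(ltW eta0)// mulr_ge0// ltW.
have TT : 0 <= T <= T by rewrite T0 lexx.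
have := gronwall T0 B0 C1 dr rB TT.
have -> : r 0 = 0 by rewrite /r x0 y0 hz M0 mulmx1 subrr.
rewrite normr0 add0r => /le_trans; apply.
rewrite (_ : _ * expR _ = E * (eta * `|h|)); last by rewrite /E; ring.
rewrite mulrA; apply: ler_wpM2r => //; rewrite /eta mulrCA -[leRHS]mulr1.
apply: ler_wpM2l; first exact: ltW.
by rewrite ler_pdivrMr// mul1r lerDl.
Qed.

Lemma flow_differentiable z x M : solution z x -> fundamental x M ->
  differentiable (flow Omega G T) z /\ forall v, 'D_v (flow Omega G T) z = v *m M T.
Proof.
move=> sx fM.
have Mc : continuous (mulmxr (M T) : 'rV[R]_d -> 'rV[R]_d).
  exact: linear_rV_continuous.
have [df dE] : differentiable (flow Omega G T) z /\
    'd (flow Omega G T) z = mulmxr (M T) :> (_ -> _).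
  apply/(differentiable_epsP _ _ Mc) => e e0.
  have [delta d0 dP] := flow_first_order sx fM e0.
  apply/nbhs_ballP; exists delta => //= h; rewrite -ball_normE /ball_/= sub0r normrN.
  move=> /ltW/dP[y sy]; rewrite (flowE oO cG T0 sy) (flowE oO cG T0 sx).
  by [].
by split=> // v; rewrite deriveE// dE.
Qed.

(** The difference of the solutions of two variational equations solves one of
    them up to a multiple of the difference of the Jacobians, which is small when
    the underlying trajectories are close. *)
Lemma fundamental_continuous z x M (v : 'rV[R]_d) e : solution z x -> fundamental x M ->
  0 < e -> exists2 delta, 0 < delta & forall z', `|z' - z| <= delta ->
    exists y M', [/\ solution z' y, fundamental y M' &
      `|v *m M' T - v *m M T| <= e].
Proof.
move=> sx [M0 dM] e0; have xc := flow_solution_continuous T0 sx.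
have [x0 xP] := sx.
have xO s (sT : 0 <= s <= T) := proj1 (xP s sT).
have [B B0 BP] := jacobian_path_bounded oO cG T0 xc xO.
have [C [delta0 [C0 d00 H]]] := flow_nearby oO cG T0 sx.
pose K := 2 * `|v| * expR (2 * B * T).
have K0 : 0 <= K by rewrite !mulr_ge0// expR_ge0.
have MK t : 0 <= t <= T -> `|v *m M t| <= K.
  have dMB s : 0 <= s <= T -> `|v *m M s *m 'J G (x s)| <= B * `|v *m M s| + 0.
    by rewrite addr0; exact: BP.
  move=> tT; have := gronwall T0 B0 (lexx 0) (dM v) dMB tT.
  by rewrite M0 mulmx1 mul0r addr0.
(* [B + d%:R] bounds the operator norm of the Jacobian along [y], the entries of
   which differ by at most 1 from those along [x]. *)
pose L := B + d%:R.
have L0 : 0 < L by rewrite ltr_wpDr.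
pose E := 2 * d%:R * K * T * expR (2 * L * T).
have E0 : 0 <= E by rewrite !mulr_ge0// expR_ge0.
pose eta := Num.min 1 (e / (E + 1)).
have E1 : 0 < E + 1 by rewrite ltr_wpDl.
have eta0 : 0 < eta by rewrite lt_min ltr01 divr_gt0.
have eta1 : eta <= 1 by rewrite ge_min lexx.
have [delta1 d10 dP] := tube oO cG T0 xc xO eta0.
exists (Num.min delta0 (delta1 / C)).
  by rewrite lt_min d00 divr_gt0.
move=> z'; rewrite le_min ler_pdivlMr// => /andP[h0 h1].
have [y [sy yx]] := H z' h0.
have [M' fM'] := fundamental_matrix oO cG T0 sy; have [M'0 dM'] := fM'.
exists y, M'; split=> //.
pose r t := v *m M' t - v *m M t.
pose r' t := v *m M' t *m 'J G (y t) - v *m M t *m 'J G (x t).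
have dr t : 0 <= t <= T -> wder T r t (r' t).
  by move=> tT; apply: wderB; [exact: dM'|exact: dM].
have rB t : 0 <= t <= T -> `|r' t| <= L * `|r t| + eta * (d%:R * K).
  move=> tT; have yd : `|y t - x t| <= delta1.
    by apply: (le_trans (yx t tT)); rewrite mulrC.
  have [_ + _] := dP t _ _ tT yd yd; rewrite (addrC (x t)) subrK => Jyx.
  have := MK t tT; have := BP t (r t) tT; rewrite /r' {dP dr fM' dM dM' BP}.
  rewrite /r; move: ('J G (y t)) ('J G (x t)) Jyx => Jy Jx Jyx Br wK.
  set w := v *m M t in wK *; set w' := v *m M' t in Br *.
  have -> : w' *m Jy - w *m Jx =
      (w' - w) *m Jx + (w' - w) *m (Jy - Jx) + w *m (Jy - Jx).
    by rewrite -mulmxDr (addrC Jx) subrK mulmxBl mulmxBr addrA subrK.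
  apply: (le_trans (ler_normD _ _)); rewrite lerD//.
    apply: (le_trans (ler_normD _ _)); rewrite /L mulrDl lerD//.
    apply: (le_trans (norm_mulmx_le _ _)); apply: ler_wpM2r => //.
    rewrite -[leRHS]mulr1; apply: ler_wpM2l => //; exact: le_trans Jyx eta1.
  apply: (le_trans (norm_mulmx_le _ _)); rewrite mulrA.
  by apply: ler_pM => //; rewrite (mulrC eta); apply: ler_wpM2l.
have C1 : 0 <= eta * (d%:R * K) by rewrite mulr_ge0 ?(ltW eta0)// mulr_ge0.
have TT : 0 <= T <= T by rewrite T0 lexx.
have := gronwall T0 L0 C1 dr rB TT.
have -> : r 0 = 0 by rewrite /r M0 M'0 subrr.
rewrite normr0 add0r => /le_trans; apply.
rewrite (_ : _ * expR _ = E * eta); last by rewrite /E; ring.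
apply: (@le_trans _ _ (E * (e / (E + 1)))).
  by rewrite ler_wpM2l// ge_min lexx orbT.
rewrite mulrCA -[leRHS]mulr1; apply: ler_wpM2l; first exact: ltW.
by rewrite ler_pdivrMr// mul1r lerDl.
Qed.

Lemma flow_class_C1 : class_C 1 (flow_domain Omega G T) (flow Omega G T).
Proof.
split=> [z [x sx]|v z [x sx]].
  have [M fM] := fundamental_matrix oO cG T0 sx.
  by case: (flow_differentiable sx fM).
have [M fM] := fundamental_matrix oO cG T0 sx.
apply: near_dist_continuous => e e0.
have [delta d0 dP] := fundamental_continuous v sx fM e0.
apply/nbhs_ballP; exists delta => //= z'; rewrite -ball_normE /ball_/= distrC.
move=> /ltW/dP[y [M' [sy fM' MM']]].
rewrite (flow_differentiable sx fM).2 (flow_differentiable sy fM').2.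
by rewrite distrC.
Qed.

End FlowSmooth.

Lemma row_mx_mul_sum (R : realType) m p q (a : 'M[R]_(m, p)) (b : 'M[R]_(m, q)) :
  row_mx a b = a *m row_mx 1%:M 0 + b *m row_mx 0 1%:M.
Proof. by rewrite !mul_mx_row !mulmx1 !mulmx0 add_row_mx addr0 add0r. Qed.

Lemma class_C_row_mx (R : realType) p q s k (U : set 'rV[R]_p)
    (f : 'rV[R]_p -> 'rV[R]_q) (g : 'rV[R]_p -> 'rV[R]_s) :
  open U -> class_C k U f -> class_C k U g ->
  class_C k U (fun x => row_mx (f x) (g x)).
Proof.
move=> oU cf cg.
have cl n (A : 'M[R]_(n, q + s)) (h : 'rV[R]_p -> 'rV[R]_n) :
    class_C k U h -> class_C k U (mulmxr A \o h).
  move=> ch; apply: (class_C_comp (V := setT)) => //; exact: class_C_linear.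
apply: (class_C_eq oU _ (class_CD oU (cl _ (row_mx 1%:M 0) _ cf)
  (cl _ (row_mx 0 1%:M) _ cg))) => x _.
by rewrite row_mx_mul_sum.
Qed.

(** The equation [z' = G z] together with its variational equation
    [w' = w *m 'J G z], for the pair [row_mx z w]. *)
Definition variational (R : realType) d (G : 'rV[R]_d -> 'rV[R]_d)
    (p : 'rV[R]_(d + d)) : 'rV[R]_(d + d) :=
  row_mx (G (lsubmx p)) (rsubmx p *m 'J G (lsubmx p)).

Lemma variational_class_C (R : realType) d k (Omega : set 'rV[R]_d) G :
  open Omega -> class_C k.+1 Omega G ->
  class_C k (lsubmx @^-1` Omega) (variational G).
Proof.
move=> oO cG; set U := _ @^-1` _.
have oU : open U by apply: open_comp => // p _; exact: continuous_lsubmx.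
have cl j (f : 'rV[R]_d -> 'rV[R]_d) : class_C j Omega f ->
    class_C j U (f \o lsubmx).
  by move=> cf; apply: (class_C_comp (V := Omega)) => //; exact: class_C_linear.
apply: (class_C_row_mx oU); first by apply: cl; exact: class_C_pred.
have ci i : class_C k U (fun p : 'rV[R]_(d + d) => rsubmx p 0 i *:
    ('D_(delta_mx 0 i) G \o lsubmx) p).
  apply: (class_C_scale (a := rsubmx)) => //; first exact: class_C_linear.
  by apply: cl; exact: cG.2.
apply: (class_C_eq oU _ (class_C_sum (index_enum 'I_d) oU ci)) => p Up.
by rewrite -deriveEjacobian ?(derive_coord_sum (rsubmx p))//; exact: cG.1.
Qed.

(** The derivative of the flow along [v] is the second component of the flow of
    the variational system started at [row_mx z v]. That system has one class
    less than [G], so induction on the class applies to it. *)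
Theorem flow_class_C (R : realType) (T : R) d r (Omega : set 'rV[R]_d) G :
  0 <= T -> open Omega -> class_C r.+1 Omega G ->
  class_C r.+1 (flow_domain Omega G T) (flow Omega G T).
Proof.
move=> T0; elim: r d Omega G => [|r IH] d Omega G oO cG.
  exact: flow_class_C1.
have cG1 := class_C_one cG.
have [dflow _] := flow_class_C1 oO cG1 T0.
split=> // v.
have oD := flow_domain_open oO cG1 T0.
pose U : set 'rV[R]_(d + d) := lsubmx @^-1` Omega.
have oU : open U.
  by apply: open_comp => // p _; exact: continuous_lsubmx.
have cV := variational_class_C oO cG.
have cV1 : class_C 1 U (variational G) := class_C_one cV.
have flowV z x M : flow_solution Omega G T z x -> fundamental G T x M ->
    flow_solution U (variational G) T (row_mx z v)
      (fun t => row_mx (x t) (v *m M t)).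
  move=> [x0 xP] [M0 dM]; split; first by rewrite x0 M0 mulmx1.
  move=> t tT; have [Oxt dx] := xP t tT.
  split; first by rewrite /U/= row_mxKl.
  rewrite /variational row_mxKl row_mxKr row_mx_mul_sum.
  rewrite (_ : (fun s => _) = (fun s => x s *m row_mx 1%:M 0 +
    v *m M s *m row_mx 0 1%:M)); last first.
    by apply/funext => s; rewrite row_mx_mul_sum.
  apply: wderD.
    exact: (wder_linear (A := mulmxr _) (@linear_rV_continuous _ _ _ _) dx).
  exact: (wder_linear (A := mulmxr _) (@linear_rV_continuous _ _ _ _) (dM v t tT)).
have cD : class_C r.+1 (flow_domain Omega G T)
    (rsubmx \o (flow U (variational G) T \o (fun z => row_mx z v))).
  apply: (class_C_comp (V := setT)) => //; last exact: class_C_linear.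
  apply: (class_C_comp (V := flow_domain U (variational G) T)) => //.
  - move=> z [x sx]; have [M fM] := fundamental_matrix oO cG1 T0 sx.
    by exists (fun t => row_mx (x t) (v *m M t)); exact: flowV.
  - apply: class_C_row_mx => //; last exact: class_C_cst.
    exact: (class_C_linear _ _ idfun).
  - exact: IH.
apply: (class_C_eq oD _ cD) => z [x sx].
have [M fM] := fundamental_matrix oO cG1 T0 sx.
rewrite /= (flowE oU cV1 T0 (flowV _ _ _ sx fM)) row_mxKr.
by have [_ ->] := flow_differentiable oO cG1 T0 sx fM.
Qed.

(** * Stacked vectors *)

Section MxvecIndex.

Lemma index_allpairs (S T : eqType) (s : seq S) (t : seq T) x y :
  x \in s -> y \in t ->
  index (x, y) [seq (a, b) | a <- s, b <- t] = (index x s * size t + index y t)%N.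
Proof.
move=> xs yt; elim: s xs => //= a s IH; rewrite inE index_cat size_map.
have [<- _|ax /= xs] := eqVneq a x.
  by rewrite map_f// index_map// => b c [].
rewrite ifF; last by apply/mapP => -[b _ [xa _]]; rewrite xa eqxx in ax.
by rewrite IH// mulSn addnA.
Qed.

(** [mxvec] lists the rows one after the other; the slice of a chart is defined by
    the numerical values of the indices. *)
Lemma val_mxvec_index m n (i : 'I_m) (j : 'I_n) :
  mxvec_index i j = (i * n + j)%N :> nat.
Proof.
rewrite /= /enum_rank enum_rank_in.unlock insubdK; last first.
  by rewrite -topredE/= cardE index_mem mem_enum.
rewrite enumT unlock /= /prod_enum index_allpairs ?mem_enum//.
by rewrite !index_enum_ord size_enum_ord.
Qed.

End MxvecIndex.

Section Blocks.
Context {R : realType} {p K : nat}.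

(** The [k]-th of the [K] vectors stacked in [v]. Taking [k : nat] instead of
    ['I_K] allows recursion on the time step; the value is 0 for [K <= k]. *)
Definition block (k : nat) : 'rV[R]_(K * p) -> 'rV[R]_p :=
  mulmx (\row_(i < K) (i == k :> nat)%:R) \o vec_mx.

HB.instance Definition _ k := GRing.Linear.on (block k).

Lemma blockE (k : 'I_K) v : block k v = row k (vec_mx v).
Proof.
rewrite /block/= rowE; congr (_ *m _); apply/rowP => i.
by rewrite !mxE eqxx.
Qed.

Lemma block_stack (v : nat -> 'rV[R]_p) k : (k < K)%N -> block k (stack K v) = v k.
Proof.
by move=> kK; rewrite (blockE (Ordinal kK)) mxvecK rowK.
Qed.

Lemma stack_block v : stack K (block ^~ v) = v.
Proof.
rewrite -[RHS]vec_mxK; congr mxvec; apply/row_matrixP => k.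
by rewrite rowK blockE.
Qed.

Lemma eq_stack (v w : nat -> 'rV[R]_p) :
  (forall k, (k < K)%N -> v k = w k) -> stack K v = stack K w.
Proof.
move=> vw; congr mxvec; apply/row_matrixP => k; rewrite !rowK; exact: vw.
Qed.

End Blocks.
Arguments block {R} p K k v.

(** * The sampled system and its behavior *)

Lemma class_C_stack (R : realType) p q K k (U : set 'rV[R]_q)
    (f : nat -> 'rV[R]_q -> 'rV[R]_p) :
  open U -> (forall j, (j < K)%N -> class_C k U (f j)) ->
  class_C k U (fun y => stack K (f ^~ y)).
Proof.
move=> oU cf.
have stackE v : stack K v = \sum_(j < K)
    (mxvec \o mulmx (delta_mx j 0 : 'M[R]_(K, 1))) (v j) :> 'rV[R]_(K * p).
  rewrite /= -linear_sum; congr mxvec; apply/matrixP => i j.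
  rewrite summxE (bigD1 i)//= !mxE big_ord1 mxE !eqxx mul1r big1 ?addr0// => l li.
  by rewrite mxE big_ord1 mxE eq_sym (negbTE li) mul0r.
have cj (j : 'I_K) : class_C k U
    ((mxvec \o mulmx (delta_mx j 0 : 'M[R]_(K, 1))) \o f j).
  apply: (class_C_comp (V := setT)) => //; first exact: cf.
  exact: class_C_linear.
apply: (class_C_eq oU _ (class_C_sum (index_enum 'I_K) oU cj)) => y _.
by rewrite stackE.
Qed.

Section ZohMap.
Context {R : realType} {n m : nat}.
Variables (Omega : set 'rV[R]_(n + m)) (F : 'rV[R]_(n + m) -> 'rV[R]_n).
Variables (Delta : R) (r : nat).
Hypotheses (oO : open Omega) (cF : class_C r.+1 Omega F) (D0 : 0 <= Delta).

(** Holding the input constant amounts to adjoining it to the state with zero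
    velocity. *)
Definition zoh_field (z : 'rV[R]_(n + m)) : 'rV[R]_(n + m) := row_mx (F z) 0.

Lemma zoh_field_class_C : class_C r.+1 Omega zoh_field.
Proof. by apply: class_C_row_mx => //; exact: class_C_cst. Qed.

Lemma zoh_solution_flow z x :
  zoh_solution Omega F Delta (lsubmx z) (rsubmx z) x ->
  flow_solution Omega zoh_field Delta z (fun t => row_mx (x t) (rsubmx z)).
Proof.
move=> [x0 xP]; split; first by rewrite x0 hsubmxK.
move=> t tT; have [Ot dx] := xP t tT; split=> //.
rewrite /zoh_field row_mx_mul_sum mul0mx.
rewrite (_ : (fun s => _) = (fun s => x s *m row_mx 1%:M 0 +
  cst (rsubmx z *m row_mx 0 1%:M) s)); last first.
  by apply/funext => s; rewrite row_mx_mul_sum.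
apply: wderD; last exact: wder_cst.
exact: (wder_linear (A := mulmxr _) (@linear_rV_continuous _ _ _ _) dx).
Qed.

Lemma flow_solution_zoh z y : flow_solution Omega zoh_field Delta z y ->
  zoh_solution Omega F Delta (lsubmx z) (rsubmx z) (lsubmx \o y).
Proof.
move=> [y0 yP].
have dr t : 0 <= t <= Delta -> wder Delta (rsubmx \o y) t 0.
  move=> tT; have := wder_linear (@continuous_rsubmx _ _ _ _) (yP t tT).2.
  by rewrite /zoh_field/= row_mxKr.
have rE t : 0 <= t <= Delta -> rsubmx (y t) = rsubmx z.
  move=> tT; apply/eqP; rewrite -subr_eq0 -normr_le0 -y0.
  have := norm_wder_le dr (fun s _ => wder_cst Delta (0 : R) s).
  by rewrite !fctE subrr; apply => // s _; rewrite normr0.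
split; first by rewrite /= y0.
move=> t tT; have [Ot dy] := yP t tT.
have yE : row_mx ((lsubmx \o y) t) (rsubmx z) = y t.
  by rewrite /= -(rE t tT) hsubmxK.
rewrite yE; split=> //.
have := wder_linear (@continuous_lsubmx _ _ _ _) dy.
by rewrite /zoh_field/= row_mxKl.
Qed.

Lemma zoh_domainE :
  zoh_domain Omega F Delta = flow_domain Omega zoh_field Delta.
Proof.
apply/seteqP; split=> z.
  by move=> [_ [x sx]]; exists (fun t => row_mx (x t) (rsubmx z));
     exact: zoh_solution_flow.
move=> [y sy]; split; last by exists (lsubmx \o y); exact: flow_solution_zoh.
by have [<- yP] := sy; have [] := yP 0; rewrite ?lexx.
Qed.

Lemma zoh_mapE z : zoh_domain Omega F Delta z ->
  zoh_map Omega F Delta z = lsubmx (flow Omega zoh_field Delta z).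
Proof.
have cG1 := class_C_one zoh_field_class_C.
move=> [_ [x0 sx0]]; rewrite /zoh_map; case: xgetP; last first.
  by move=> /(_ (x0 Delta)); case; exists x0.
move=> y _ [x sx <-].
by rewrite (flowE oO cG1 D0 (zoh_solution_flow sx)) row_mxKl.
Qed.

Lemma zoh_domain_open : open (zoh_domain Omega F Delta).
Proof.
rewrite zoh_domainE; apply: flow_domain_open => //.
exact: class_C_one zoh_field_class_C.
Qed.

Lemma zoh_map_class_C :
  class_C r.+1 (zoh_domain Omega F Delta) (zoh_map Omega F Delta).
Proof.
have cS : class_C r.+1 (zoh_domain Omega F Delta)
    (lsubmx \o flow Omega zoh_field Delta).
  rewrite zoh_domainE; apply: (class_C_comp (V := setT)) => //.
  - by rewrite -zoh_domainE; exact: zoh_domain_open.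
  - exact: flow_class_C D0 oO zoh_field_class_C.
  - exact: class_C_linear.
by apply: (class_C_eq zoh_domain_open _ cS) => z /zoh_mapE ->.
Qed.

End ZohMap.

Section Behavior.
Context {R : realType} {n m : nat}.
Variables (N : nat) (D : set 'rV[R]_(n + m)) (S : 'rV[R]_(n + m) -> 'rV[R]_n).
Local Notation space := 'rV[R]_(N * m + N.+1 * n).

Definition input (k : nat) : space -> 'rV[R]_m := block m N k \o lsubmx.
Definition state (k : nat) : space -> 'rV[R]_n := block n N.+1 k \o rsubmx.

(** The state at step [k] of the recursion [x_(k+1) = S (x_k, u_k) + d_(k+1)], when
    [d_1, ..., d_N] are stored in [y] at the places of the states after the
    first: running it recovers the states from their defects. *)
Fixpoint trajectory (k : nat) (y : space) : 'rV[R]_n :=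
  if k is k'.+1 then
    state k y + S (row_mx (trajectory k' y) (input k' y))
  else state 0 y.

Definition defect (k : nat) (w : space) : 'rV[R]_n :=
  if k is k'.+1 then state k w - S (row_mx (state k' w) (input k' w))
  else state 0 w.

Definition straighten (w : space) : space :=
  row_mx (lsubmx w) (stack N.+1 (defect ^~ w)).
Definition unstraighten (y : space) : space :=
  row_mx (lsubmx y) (stack N.+1 (trajectory ^~ y)).

Definition admissible (j : nat) (x : nat -> space -> 'rV[R]_n) : set space :=
  [set w | forall k, (k < j)%N -> D (row_mx (x k w) (input k w))].

Lemma admissibleS j x : admissible j.+1 x =
  admissible j x `&` (fun w => row_mx (x j w) (input j w)) @^-1` D.
Proof.
apply/seteqP; split=> w.
  by move=> H; split; [move=> k kj; apply: H; rewrite ltnW|exact: H].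
by move=> [H1 H2] k; rewrite ltnS leq_eqVlt => /predU1P[->//|]; exact: H1.
Qed.

Lemma input_row_mx k (w : space) v : input k (row_mx (lsubmx w) v) = input k w.
Proof. by rewrite /input/= row_mxKl. Qed.

Lemma state_row_mx k a (x : nat -> 'rV[R]_n) : (k <= N)%N ->
  state k (row_mx a (stack N.+1 x) : space) = x k.
Proof. by move=> kN; rewrite /state/= row_mxKr block_stack. Qed.

Lemma trajectory_straighten w k : (k <= N)%N ->
  trajectory k (straighten w) = state k w.
Proof.
elim: k => [|k IH] kN; rewrite /= /straighten state_row_mx//.
by rewrite -/(straighten w) (IH (ltnW kN)) /straighten input_row_mx/= subrK.
Qed.

Lemma defect_unstraighten y k : (k <= N)%N ->
  defect k (unstraighten y) = state k y.
Proof.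
case: k => [|k] kN; rewrite /= /unstraighten state_row_mx//.
by rewrite state_row_mx 1?ltnW// input_row_mx/= addrK.
Qed.

Lemma straightenK w : unstraighten (straighten w) = w.
Proof.
rewrite /unstraighten {1}/straighten row_mxKl.
rewrite (eq_stack (w := (block n N.+1) ^~ (rsubmx w))) ?stack_block ?hsubmxK//.
by move=> k kN; rewrite trajectory_straighten.
Qed.

Lemma unstraightenK y : straighten (unstraighten y) = y.
Proof.
rewrite /straighten {1}/unstraighten row_mxKl.
rewrite (eq_stack (w := (block n N.+1) ^~ (rsubmx y))) ?stack_block ?hsubmxK//.
by move=> k kN; rewrite defect_unstraighten.
Qed.

(** The inputs and the initial state fill the first [n + N * m] coordinates, so the
    slice asks for all later blocks to vanish. *)
Lemma coordinate_sliceE y :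
  coordinate_slice R _ (n + N * m) y <->
  forall k, (k < N)%N -> state k.+1 y = 0.
Proof.
split=> [y0 k kN|y0 i].
  have kN1 : (k.+1 < N.+1)%N by [].
  rewrite /state/= (blockE (Ordinal kN1)); apply/rowP => j.
  rewrite !mxE; apply: y0; apply: (@leq_trans (N * m + (k.+1 * n + j))%N).
    by rewrite addnC leq_add2l mulSn -addnA leq_addr.
  by rewrite -[(k.+1 * n + j)%N](val_mxvec_index (Ordinal kN1) j).
case: (split_ordP i) => j ->.
  rewrite leqNgt (_ : (_ < _)%N)//=.
  by rewrite (leq_trans (ltn_ord j))// leq_addl.
suff H : (n + N * m <= N * m + j)%N -> y 0 (rshift (N * m) j) = 0 by exact: H.
rewrite addnC leq_add2l; case/mxvec_indexP: j => a b; rewrite val_mxvec_index.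
case: a => -[|a] /= aN; first by rewrite mul0n add0n leqNgt ltn_ord.
move=> _; have := y0 a aN; rewrite /state/= (blockE (Ordinal aN)).
by move=> /rowP/(_ b); rewrite !mxE.
Qed.

Lemma behavior_straighten w :
  (exists (u : nat -> 'rV[R]_m) (x : nat -> 'rV[R]_n),
     w = row_mx (stack N u) (stack N.+1 x) /\
     forall k, (k < N)%N ->
       D (row_mx (x k) (u k)) /\ x k.+1 = S (row_mx (x k) (u k))) <->
  admissible N state w /\ coordinate_slice R _ (n + N * m) (straighten w).
Proof.
split=> [[u [x [-> H]]]|[Dw /coordinate_sliceE w0]].
  have inE k : (k < N)%N -> input k (row_mx (stack N u) (stack N.+1 x)) = u k.
    by move=> kN; rewrite /input/= row_mxKl block_stack.
  split.
    by move=> k kN; rewrite /= state_row_mx 1?ltnW// inE//; case: (H k kN).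
  apply/coordinate_sliceE => k kN.
  rewrite /straighten state_row_mx//= !state_row_mx// 1?ltnW// inE//.
  by case: (H k kN) => _ ->; rewrite subrr.
exists (input ^~ w), (state ^~ w); split.
  by rewrite /input /state/= !stack_block hsubmxK.
move=> k kN; split; first exact: Dw.
by apply/eqP; rewrite -subr_eq0 -[X in X == _]/(defect k.+1 w);
   rewrite -(w0 k kN) /straighten state_row_mx.
Qed.

Section Smooth.
Variable r : nat.
Hypotheses (oD : open D) (cS : class_C r D S).

Lemma input_class_C (U : set space) k : class_C r U (input k).
Proof. exact: class_C_linear. Qed.

Lemma state_class_C (U : set space) k : class_C r U (state k).
Proof. exact: class_C_linear. Qed.

Lemma class_C_step (U : set space) (x : space -> 'rV[R]_n) k : open U ->
  class_C r U x -> (forall w, U w -> D (row_mx (x w) (input k w))) ->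
  class_C r U (fun w => S (row_mx (x w) (input k w))).
Proof.
move=> oU cx UD; apply: (class_C_comp (f := fun w => row_mx (x w) (input k w)) oU UD) => //.
by apply: class_C_row_mx => //; exact: input_class_C.
Qed.

(** Class and openness go together: [trajectory k] is only known to be continuous
    where the first [k] steps are admissible, and this continuity is what makes
    the set where one more step is admissible open. *)
Lemma trajectory_class_C j :
  open (admissible j trajectory) /\
  forall k, (k <= j)%N -> class_C r (admissible j trajectory) (trajectory k).
Proof.
elim: j => [|j [oA cA]].
  rewrite (_ : admissible 0 trajectory = setT); last by apply/seteqP; split.
  split; first exact: openT.
  by case=> // _; exact: state_class_C.
pose P w := row_mx (trajectory j w) (input j w) : 'rV[R]_(n + m).
have cP : class_C r (admissible j trajectory) P.
  by apply: class_C_row_mx => //; [exact: cA|exact: input_class_C].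
have oA' : open (admissible j.+1 trajectory).
  rewrite admissibleS openE => w [Aw Dw]; apply: filterI; first exact: open_nbhs_nbhs.
  apply: (class_C_continuous cP Aw); exact: open_nbhs_nbhs.
split=> // k; rewrite leq_eqVlt => /predU1P[->|kj]; last first.
  apply: class_C_sub (cA k kj) => w H i ij; apply: H; exact: leqW.
have cT : class_C r (admissible j.+1 trajectory) (trajectory j).
  by apply: class_C_sub (cA j (leqnn j)) => w H i ij; apply: H; exact: leqW.
have cStep := class_C_step oA' cT (fun w Hw => Hw j (leqnn j.+1)).
exact: (class_CD oA' (state_class_C _ j.+1) cStep).
Qed.

Lemma admissible_state_open j : open (admissible j state).
Proof.
elim: j => [|j oA].
  by rewrite (_ : admissible 0 state = setT);
     [exact: openT|apply/seteqP; split].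
rewrite admissibleS; apply: openI => //; apply: open_comp => // w _.
have cP : class_C r setT (fun w => row_mx (state j w) (input j w)).
  apply: class_C_row_mx; [exact: openT|exact: state_class_C|exact: input_class_C].
exact: (class_C_continuous cP).
Qed.

Lemma straighten_class_C : class_C r (admissible N state) straighten.
Proof.
have oU : open (admissible N state) by exact: admissible_state_open.
apply: class_C_row_mx => //; first exact: class_C_linear.
apply: class_C_stack => // -[|k] kN; first exact: state_class_C.
have cStep : class_C r (admissible N state)
    (fun w => S (row_mx (state k w) (input k w))).
  by apply: class_C_step => // [|w]; [exact: state_class_C|exact].
have cN : class_C r (admissible N state)
    (mulmxr (- 1%:M) \o (fun w => S (row_mx (state k w) (input k w)))).
  by apply: (class_C_comp (V := setT)) => //; exact: class_C_linear.
apply: (class_C_eq oU _ (class_CD oU (state_class_C _ k.+1) cN)) => w _.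
by rewrite fctE /= mulmxN mulmx1.
Qed.

Lemma unstraighten_class_C : class_C r (admissible N trajectory) unstraighten.
Proof.
have [oV cT] := trajectory_class_C N.
apply: class_C_row_mx => //; first exact: class_C_linear.
by apply: class_C_stack => // k kN; exact: cT.
Qed.

(** The behavior is the zero set of the defects, and exchanging states for defects
    is a triangular change of coordinates: it is inverted by running the recursion
    and so is a single global chart. *)
Lemma behavior_submanifold :
  embedded_submanifold r (n + N * m)
    [set w : space | exists (u : nat -> 'rV[R]_m) (x : nat -> 'rV[R]_n),
      w = row_mx (stack N u) (stack N.+1 x) /\
      forall k, (k < N)%N ->
        D (row_mx (x k) (u k)) /\ x k.+1 = S (row_mx (x k) (u k))].
Proof.
move=> p /behavior_straighten[Up _]; split.
  by rewrite addnC leq_add2l mulSn leq_addr.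
have UV w : admissible N state w -> admissible N trajectory (straighten w).
  move=> Uw k kN; rewrite /= trajectory_straighten 1?ltnW// input_row_mx.
  exact: Uw.
have VU y : admissible N trajectory y -> admissible N state (unstraighten y).
  move=> Vy k kN; rewrite /= /unstraighten input_row_mx state_row_mx 1?ltnW//.
  exact: Vy.
exists (admissible N state), (admissible N trajectory), straighten, unstraighten.
split=> //.
- exact: admissible_state_open.
- by case: (trajectory_class_C N).
- split.
  + exact: straighten_class_C.
  + exact: unstraighten_class_C.
  + by move=> _ [w Uw <-]; exact: UV.
  + by move=> _ [y Vy <-]; exact: VU.
  + by split=> ? _; [exact: straightenK|exact: unstraightenK].
apply/seteqP; split=> [_ [w [/behavior_straighten[_ w0] Uw] <-]|y [Vy y0]].
  by split=> //; exact: UV.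
exists (unstraighten y); last exact: unstraightenK.
split; last exact: VU.
by apply/behavior_straighten; rewrite unstraightenK; split=> //; exact: VU.
Qed.

End Smooth.
End Behavior.

Theorem corollary6p3 (R : realType) (n m N r : nat)
    (Omega : set 'rV[R]_(n + m)) (F : 'rV[R]_(n + m) -> 'rV[R]_n) (Delta : R)
    (n_gt0 : (0 < n)%N) (m_gt0 : (0 < m)%N) (N_gt0 : (0 < N)%N)
    (r_gt0 : (1 <= r)%N)
    (Omega_open : open Omega) (F_Cr : class_C r Omega F)
    (Delta_gt0 : 0 < Delta) :
  embedded_submanifold r (n + N * m) (zoh_behavior Omega F Delta N).
Proof.
case: r r_gt0 F_Cr => // r _ F_Cr; have D0 := ltW Delta_gt0.
apply: behavior_submanifold; first exact: zoh_domain_open F_Cr D0.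
exact: zoh_map_class_C.
Qed.
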